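(* Consider a one-dimensional network of elastoplastic springs as described in the context, and assume in addition: (i) the number of displacement-controlled loadings is $q=n-2$; (ii) no spring is blocked by the displacement-controlled loadings; (iii) the loadings $l$ and $\bar h$ are $T$-periodic and Lipschitz continuous. Let $\bar u$ be a nonzero vector of $U$ (under (i), $\dim U=1$), and let $\bar c^{+},\bar c^{-}\in\mathbb{R}^m$ be defined by $\bar c^{+}_i=c_i^{\operatorname{sign}(\bar u_i)}$, $\bar c^{-}_i=c_i^{-\operatorname{sign}(\bar u_i)}$, where $c_i^{+1}:=c_i^+$ and $c_i^{-1}:=c_i^-$; write $\bar c^{+1}:=\bar c^+$, $\bar c^{-1}:=\bar c^-$. Assume that the stress loading is large in the sense that for at least one $k\in\{-1,+1\}$, $$\Big\langle\bar u,\ (\bar c^{k}_1,\dots,\bar c^{k}_{j-1},\bar c^{-k}_j,\bar c^{k}_{j+1},\dots,\bar c^{k}_m)^\top+Ah(t)\Big\rangle\cdot\big\langle\bar u,\ \bar c^k+Ah(t)\big\rangle\le 0\quad\text{for all } j\in\{1,\dots,m\},\ t\in[0,T],$$ and that the displacement-controlled loading is large in the sense that $$\|A^{-1}c^- - A^{-1}c^+\|_A<\|g(t_1)-g(t_2)\|_A\quad\text{for some }0\le t_1<t_2,$$ where $c^\pm=(c_1^\pm,\dots,c_m^\pm)^\top$ and $\|x\|_A=\sqrt{\langle x,Ax\rangle}$. Then there exists a $T$-periodic function $s_0:[0,\infty)\to\mathbb{R}^m$ such that $\|s(t)-s_0(t)\|\to 0$ as $t\to\infty$ for the stress component $s$ of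 any solution $(s,e,p,r)$ of the variational system on $[0,\infty)$.
   Context: Network: $n$ nodes with displacements $\xi\in\mathbb{R}^n$ and $m$ springs; spring $k$ joins a left node $i_k$ to a right node $j_k\neq i_k$, and the graph formed by the nodes and springs is connected. The kinematic matrix $D$ is the $m\times n$ matrix with $(D\xi)_k=\xi_{j_k}-\xi_{i_k}$. $A=\mathrm{diag}(a_1,\dots,a_m)$ with $a_k>0$ (Hooke coefficients); $c_k^-<c_k^+$ are elastic limits, $C=\prod_{k=1}^m[c_k^-,c_k^+]\subset\mathbb{R}^m$, and $N_C(x)=\{\zeta:\langle\zeta,c-x\rangle\le0\ \forall c\in C\}$ if $x\in C$, $N_C(x)=\emptyset$ otherwise. There are $q$ displacement-controlled loadings: the $k$-th prescribes $\xi_{J_k}-\xi_{I_k}=l_k(t)$ for given nodes $I_k,J_k$; $R^k\in\{-1,0,1\}^m$ is the signed incidence vector of a chain of springs from $I_k$ to $J_k$, so that $(R^k)^\top D\xi=\xi_{J_k}-\xi_{I_k}$ for all $\xi$; $R=(R^1,\dots,R^q)$ ($m\times q$); it is assumed that $\mathrm{rank}(R^\top D)=q$. The stress-controlled loading (external nodal forces) is $f(t)=-D^\top\bar h(t)$ with $\bar h:\mathbb{R}\to\mathbb{R}^m$ continuous. Variational system for $s,e,p\in\mathbb{R}^m$, $r\in\mathbb{R}^q$: $s=Ae$, $\dot p\in N_C(s)$, $e+p\in D\mathbb{R}^n$, $R^\top(e+p)=l(t)$, $\sum_{k=1}^m s_k s^k+\sum_{k=1}^q r_k r^k+f(t)=0$,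 where $s^k\in\mathbb{R}^n$ has entries $s^k_{i_k}=1$, $s^k_{j_k}=-1$ and $0$ otherwise, and $r^k\in\mathbb{R}^n$ has $r^k_{I_k}=1$, $r^k_{J_k}=-1$ and $0$ otherwise; solutions are absolutely continuous and satisfy the relations a.e. Let $L$ be an $n\times q$ matrix with $R^\top D L=I_{q}$. $U=\{x\in D\mathbb{R}^n: R^\top x=0\}$, $U^\perp$ its Euclidean orthogonal complement, $V=A^{-1}U^\perp$; $\mathbb{R}^m=U\oplus V$ is orthogonal for $(u,v)_A=\langle u,Av\rangle$, and $P_U,P_V$ are the corresponding projections. Effective loadings: $g(t)=P_VDL\,l(t)$, $h(t)=P_UA^{-1}\bar h(t)$. A spring is blocked by the displacement-controlled loadings if its two endpoints are connected by a chain of pairs $\{I_k,J_k\}$ of displacement-controlled loadings. *)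

(* Defs.v *)
From HB Require Import structures.
From mathcomp Require Import all_boot all_order all_algebra.
From mathcomp Require Import all_classical all_reals all_analysis.
Set Implicit Arguments. Unset Strict Implicit. Unset Printing Implicit Defensive.
Import Order.TTheory GRing.Theory Num.Theory numFieldNormedType.Exports.
Local Open Scope ring_scope.
Local Open Scope classical_set_scope.

Section Defs.
Variable R : realType.

Definition dotv k (x y : 'cV[R]_k) : R := \sum_(i < k) x i 0 * y i 0.
Definition enorm k (x : 'cV[R]_k) : R := Num.sqrt (dotv x x).

Definition diagA m (a : 'I_m -> R) : 'M[R]_m := diag_mx (\row_i a i).
Definition normA m (a : 'I_m -> R) (x : 'cV[R]_m) : R :=
  Num.sqrt (dotv x (diagA a *m x)).

Definition kinD m n (il jl : 'I_m -> 'I_n) : 'M[R]_(m, n) :=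
  \matrix_(k, x) ((x == jl k)%:R - (x == il k)%:R).

Definition svec m n (il jl : 'I_m -> 'I_n) (k : 'I_m) : 'cV[R]_n :=
  \col_x ((x == il k)%:R - (x == jl k)%:R).
Definition rvec q n (Il Jl : 'I_q -> 'I_n) (k : 'I_q) : 'cV[R]_n :=
  \col_x ((x == Il k)%:R - (x == Jl k)%:R).

Definition inC m (cm cp : 'I_m -> R) (x : 'cV[R]_m) : Prop :=
  forall k, cm k <= x k 0 <= cp k.
Definition normal_cone m (cm cp : 'I_m -> R) (x zeta : 'cV[R]_m) : Prop :=
  inC cm cp x /\ forall c, inC cm cp c -> dotv zeta (c - x) <= 0.

Definition in_rangeD m n (D : 'M[R]_(m, n)) (x : 'cV[R]_m) : Prop :=
  exists xi : 'cV[R]_n, x = D *m xi.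
Definition inU m n q (D : 'M[R]_(m, n)) (Rm : 'M[R]_(m, q)) (x : 'cV[R]_m) :=
  in_rangeD D x /\ Rm^T *m x = 0.
Definition inV m n q (a : 'I_m -> R) (D : 'M[R]_(m, n)) (Rm : 'M[R]_(m, q))
  (x : 'cV[R]_m) : Prop :=
  exists w : 'cV[R]_m, (forall u, inU D Rm u -> dotv w u = 0) /\
                       x = invmx (diagA a) *m w.
(* projections of the decomposition R^m = U (+) V *)
Definition projU m n q (a : 'I_m -> R) (D : 'M[R]_(m, n)) (Rm : 'M[R]_(m, q))
  (x : 'cV[R]_m) : 'cV[R]_m :=
  xget 0 [set u | inU D Rm u /\ inV a D Rm (x - u)].
Definition projV m n q (a : 'I_m -> R) (D : 'M[R]_(m, n)) (Rm : 'M[R]_(m, q))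
  (x : 'cV[R]_m) : 'cV[R]_m := x - projU a D Rm x.

Definition abs_cont_on (f : R -> R) (x0 y0 : R) : Prop :=
  forall eps, 0 < eps -> exists2 delta, 0 < delta &
    forall (N : nat) (lo hi : nat -> R),
      (forall k, (k < N)%N -> x0 <= lo k /\ lo k <= hi k /\ hi k <= y0) ->
      (forall k, (k.+1 < N)%N -> hi k <= lo k.+1) ->
      \sum_(k < N) (hi k - lo k) < delta ->
      \sum_(k < N) `|f (hi k) - f (lo k)| < eps.
Definition abs_cont_vec k (f : R -> 'cV[R]_k) : Prop :=
  forall (i : 'I_k) (b : R), 0 <= b -> abs_cont_on (fun t => f t i 0) 0 b.

Definition Tperiodic X (T : R) (f : R -> X) : Prop := forall t, f (t + T) = f t.
Definition lipschitz_vec k (f : R -> 'cV[R]_k) : Prop :=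
  exists L : R, forall t1 t2 (i : 'I_k), `|f t1 i 0 - f t2 i 0| <= L * `|t1 - t2|.

Definition edge_rel m n (il jl : 'I_m -> 'I_n) : rel 'I_n :=
  fun x y => [exists k, ((il k == x) && (jl k == y)) || ((il k == y) && (jl k == x))].
Definition blocked m n q (il jl : 'I_m -> 'I_n) (Il Jl : 'I_q -> 'I_n) (k : 'I_m) :=
  connect (edge_rel Il Jl) (il k) (jl k).

(* cbar^{k}, with k = true meaning +1 and k = false meaning -1:
   cbar^{k}_i = c_i^{k sign(ubar_i)}; for ubar_i = 0 (value irrelevant) we take c^+_i *)
Definition cbar m (cm cp : 'I_m -> R) (ubar : 'cV[R]_m) (k : bool) : 'cV[R]_m :=
  \col_i (if (0 <= ubar i 0) == k then cp i else cm i).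
Definition cbar_flip m (cm cp : 'I_m -> R) (ubar : 'cV[R]_m) (k : bool) (j : 'I_m)
  : 'cV[R]_m :=
  \col_i (if i == j then cbar cm cp ubar (~~ k) i 0 else cbar cm cp ubar k i 0).

Definition solution m n q (a : 'I_m -> R) (cm cp : 'I_m -> R)
  (il jl : 'I_m -> 'I_n) (Il Jl : 'I_q -> 'I_n) (Rm : 'M[R]_(m, q))
  (l : R -> 'cV[R]_q) (hbar : R -> 'cV[R]_m)
  (s e p : R -> 'cV[R]_m) (r : R -> 'cV[R]_q) : Prop :=
  let D := kinD il jl in
  [/\ abs_cont_vec s, abs_cont_vec e, abs_cont_vec p, abs_cont_vec r &
    {ae lebesgue_measure, forall t : R, 0 <= t ->
      [/\ s t = diagA a *m e t,
          ((forall i, derivable (fun x => p x i 0) t 1) /\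
           normal_cone cm cp (s t) (\col_i ('D_1 (fun x => p x i 0) t))),
          in_rangeD D (e t + p t),
          Rm^T *m (e t + p t) = l t &
          \sum_(k < m) s t k 0 *: svec il jl k + \sum_(k < q) r t k 0 *: rvec Il Jl k
            + (- (D^T *m hbar t)) = 0]}].

End Defs.

(* Main.v *)
(* Since [U] is a line spanned by [ubar] and no spring is blocked, all components
   of [u = +-ubar] are nonzero. The large stress loading makes the admissible
   stresses at each time a simplex whose facets are [s_i = corner_i].
   For two solutions put [delta_i = (p1_i - p2_i) / u_i]. Geometric compatibility
   and balance give [(s1_i - s2_i) / (a_i u_i) = avg - delta_i], with [avg] a fixed
   weighted mean of [delta], and the flow rule makes each [delta_i] move only
   towards [avg]. So the spread of [delta] is nonincreasing, and it contracts by
   a fixed factor over any time window in which one of the solutions visits every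
   facet, because [delta_i <= avg] at a visit to facet [i]. The large displacement
   loading forces such visits within windows of a fixed length: while facet [j]
   is missed, the quantities [p_i / u_i - p_j / u_j] are monotone and bounded,
   hence almost constant over some period, and then the elastic part alone would
   have to follow [g]. Hence any two solutions approach each other at a uniform
   rate; comparing a solution with its translates by multiples of [T] shows that
   these converge, and their limit is [s0]. *)

Require Import Defs.
From HB Require Import structures.
From mathcomp Require Import all_boot all_order all_algebra.
From mathcomp Require Import all_classical all_reals all_analysis.
From mathcomp Require Import lra ring zify.
Import Order.TTheory GRing.Theory Num.Theory numFieldNormedType.Exports.
Local Open Scope ring_scope.
Local Open Scope classical_set_scope.

(** * Absolutely continuous functions *)

(** The difference quotients on both sides of [t] stay below [eta], and the two estimates add up
    when [y <= t <= z]. *)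
Lemma derive_le0_local (R : realType) (f : R -> R) (t eta : R) :
  derivable f t 1 -> 'D_1 f t <= 0 -> 0 < eta ->
  exists2 r, 0 < r & forall y z, t - r < y -> y <= t -> t <= z -> z < t + r ->
    f z - f y <= eta * (z - y).
Proof.
move=> /cvg_ex[D HD] D0 eta0.
have DE : 'D_1 f t = D by apply: cvg_lim.
rewrite DE in D0.
move/cvgrPdist_lt: HD => /(_ _ eta0) /nbhs_ballP[r /= r0 Hr].
have H h : h != 0 -> `|h| < r -> h^-1 * (f (h + t) - f t) < eta.
  move=> h0 hr.
  have := Hr h; rewrite /ball /= sub0r normrN => /(_ hr h0).
  rewrite [h *: 1]mulr1.
  have := ler_norm (- (D - h^-1 *: (f (h + t) - f t))); rewrite normrN /GRing.scale /=.
  lra.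
have Hz z : t <= z -> z < t + r -> f z - f t <= eta * (z - t).
  move=> tz zr; have [->|zt] := eqVneq z t; first by rewrite !subrr mulr0.
  have zt0 : 0 < z - t by rewrite subr_gt0 lt_neqAle eq_sym zt.
  have := H (z - t) (lt0r_neq0 zt0); rewrite gtr0_norm // subrK.
  rewrite mulrC ltr_pdivrMr // => h; apply: ltW; apply: h; lra.
have Hy y : t - r < y -> y <= t -> f t - f y <= eta * (t - y).
  move=> yr yt; have [->|ty] := eqVneq y t; first by rewrite !subrr mulr0.
  have yt0 : y - t < 0 by rewrite subr_lt0 lt_neqAle ty.
  have := H (y - t) (ltr0_neq0 yt0); rewrite ltr0_norm // subrK.
  rewrite mulrC ltr_ndivrMr // => h.
  have : eta * (y - t) < f y - f t by apply: h; lra.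
  lra.
exists r => // y z h1 h2 h3 h4.
have := Hz z h3 h4; have := Hy y h1 h2; lra.
Qed.

(* Cousin-type argument: the increment of [f] is controlled by the derivative
   away from the null set, and elsewhere by the small total length of intervals
   contained in an open cover [W] of the null set. *)
Lemma abs_cont_ae_derive_le0 (R : realType) (f : R -> R) (a b s t : R) :
  abs_cont_on f a b -> a <= s -> s <= t -> t <= b ->
  {ae lebesgue_measure, forall x : R, s <= x <= t -> derivable f x 1 /\ 'D_1 f x <= 0} ->
  f t <= f s.
Proof.
move=> ac as_ st tb ae.
suff key eta : 0 < eta -> f t - f s <= eta * (t - s) + eta.
  rewrite -subr_le0; apply/ler_addgt0Pr => e e0; rewrite add0r.
  have d0 : 0 < t - s + 1 by lra.
  have := key (e / (t - s + 1)) (divr_gt0 e0 d0).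
  by have -> : e / (t - s + 1) * (t - s) + e / (t - s + 1) = e by field; lra.
move=> eta0.
have [del del0 Hdel] := ac eta eta0.
have [Z [mZ Z0 sZ]] := ae.
have [W [oW ZW mW]] : exists W : set R, [/\ open W, Z `<=` W &
    (lebesgue_measure W < del%:E)%E].
  have Zoo : (lebesgue_measure Z < +oo)%E by rewrite [X in (X < _)%E]Z0.
  have [W [oW ZW mW]] := lebesgue_regularity_outer mZ Zoo del0.
  exists W; split => //.
  have mW' : measurable W by exact: measurable_realfun.open_measurable.
  have -> : W = (W `\` Z) `|` Z by rewrite setUC setDUK.
  rewrite measureU //=; [|exact: measurableD| by rewrite setDKI].
  by rewrite [X in (_ + X < _)%E]Z0 adde0.
have mW' : measurable W by exact: measurable_realfun.open_measurable.
(* The growth over [[s, y]] is paid for by slope [eta] and by the variation over finitely many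
   intervals whose total length fits into [W]; at [y = t] absolute continuity bounds that variation
   by [eta]. *)
pose P y := exists N : nat, exists lo hi : nat -> R,
  [/\ forall k, (k < N)%N -> s <= lo k /\ lo k <= hi k /\ hi k <= y,
      forall k, (k.+1 < N)%N -> hi k <= lo k.+1,
      ((\sum_(k < N) (hi k - lo k))%:E <= lebesgue_measure (W `&` `[s, y]))%E &
      f y - f s <= eta * (y - s) + \sum_(k < N) `|f (hi k) - f (lo k)|].
have Pt : P t -> f t - f s <= eta * (t - s) + eta.
  move=> [N [lo [hi [h1 h2 h3 h4]]]]; apply: (le_trans h4); rewrite lerD2l.
  apply: ltW; apply: Hdel.
  - by move=> k kN; have [? [? ?]] := h1 k kN; split; [lra|split; [|lra]].
  - exact: h2.
  - rewrite -lte_fin; apply: (le_lt_trans h3); apply: le_lt_trans mW.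
    by apply: le_measure; rewrite ?inE //; exact: measurableI.
apply: Pt.
have Ps : P s.
  exists 0%N, (fun=> 0), (fun=> 0); split => //; last by rewrite big_ord0 !subrr; lra.
  by rewrite big_ord0.
have Pnull y z : s <= y -> y <= z -> P y -> f z - f y <= eta * (z - y) -> P z.
  move=> sy yz [N [lo [hi [h1 h2 h3 h4]]]] H; exists N, lo, hi; split => //.
  - by move=> k /h1 [? [? ?]]; split => //; split => //; lra.
  - apply: (le_trans h3); apply: le_measure; rewrite ?inE //; try exact: measurableI.
    move=> x [Wx /=]; rewrite !in_itv /= => /andP[-> xy]; split => //.
    exact: le_trans yz.
  - lra.
have PW y z : s <= y -> y <= z -> P y -> `[y, z] `<=` W -> P z.
  move=> sy yz [N [lo [hi [h1 h2 h3 h4]]]] H.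
  exists N.+1, (fun k => if (k < N)%N then lo k else y),
    (fun k => if (k < N)%N then hi k else z); split.
  - move=> k kN; case: ifPn => [/h1 [? [? ?]]|_]; split => //; split => //; lra.
  - move=> k; rewrite ltnS => kN; rewrite kN; case: ifPn => [|_]; first exact: h2.
    by have [_ [_ ]] := h1 k kN.
  - rewrite big_ord_recr /= ltnn.
    under eq_bigr => i _ do rewrite ltn_ord.
    have -> : W `&` `[s, z] = (W `&` `[s, y]) `|` `]y, z].
      apply/seteqP; split => x /=; rewrite !in_itv /=.
        move=> [Wx /andP[sx xz]]; have [xy|yx] := leP x y.
          by left; split => //; rewrite sx.
        by right; rewrite xz.
      move=> [[Wx /andP[sx xy]]|/andP[yx xz]].
        by split => //; rewrite sx /= (le_trans xy).
      split; last by apply/andP; split => //; lra.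
      by apply: H; rewrite /= in_itv /= xz ltW.
    rewrite measureU //=; last 2 first.
      exact: measurableI.
      apply/seteqP; split => x //= [[_]]; rewrite !in_itv /= => /andP[_ xy] /andP[yx _].
      lra.
    rewrite EFinD; apply: leeD => //.
    rewrite lebesgue_measure_itv /= lte_fin.
    case: ltP => [_|zy]; first by rewrite EFinN -EFinB.
    by rewrite lee_fin; lra.
  - rewrite big_ord_recr /= ltnn.
    under eq_bigr => i _ do rewrite ltn_ord.
    have := ler_norm (f z - f y).
    have : 0 <= eta * (z - y) by rewrite mulr_ge0 ?subr_ge0 // ltW.
    lra.
pose E := [set y | s <= y <= t /\ P y].
have Es : E s by split => //; rewrite lexx st.
have ubE : has_ubound E by exists t => y [/andP[_ ]].
pose c := sup E.
have sc : s <= c by exact: ub_le_sup.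
have ct : c <= t by apply: ge_sup; [exists s|move=> y [/andP[_ ]]].
(* [P] passes across [c]: through [W] if [c] is in the null set, by the derivative otherwise. Hence
   the supremum [c] cannot lie before [t]. *)
have step : exists2 r, 0 < r & forall y z, c - r < y -> y <= c -> c <= z -> z < c + r ->
    s <= y -> z <= t -> P y -> P z.
  have [Zc|nZc] := pselect (Z c).
    have : nbhs c W by apply: open_nbhs_nbhs; split => //; exact: ZW.
    move=> /nbhs_ballP[r /= r0 Hr]; exists r => // y z h1 h2 h3 h4 sy zt Py.
    apply: (PW y) => //; first lra.
    move=> x /=; rewrite in_itv /= => /andP[yx xz]; apply: Hr.
    by rewrite /ball /= ltr_norml; apply/andP; split; lra.
  have [dc Dc] : derivable f c 1 /\ 'D_1 f c <= 0.
    apply: contrapT => nD; apply: nZc; apply: sZ => /= H; apply: nD; apply: H.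
    by rewrite sc.
  have [r r0 Hr] := derive_le0_local R f c eta dc Dc eta0.
  exists r => // y z h1 h2 h3 h4 sy zt Py.
  by apply: (Pnull y) => //; [lra|apply: Hr].
have [r r0 Hr] := step.
have [y Ey yc] := sup_adherent r0 (conj (ex_intro _ s Es) ubE).
have [/andP[sy yt] Py] := Ey.
have yc' : y <= c by exact: ub_le_sup.
have [->|nct] := eqVneq t c; first by apply: (Hr y) => //; lra.
have ct' : c < t by rewrite lt_neqAle eq_sym nct.
pose z := Num.min t (c + r / 2).
have cz : c < z by rewrite lt_min ct' /=; lra.
have zt : z <= t by rewrite ge_min lexx.
have zr : z <= c + r / 2 by rewrite ge_min lexx orbT.
have : E z.
  split; first by rewrite zt andbT; lra.
  by apply: (Hr y) => //; lra.
by move=> /(ub_le_sup ubE); rewrite -/c leNgt cz.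
Qed.

Lemma ae_dense (R : realType) (P : R -> Prop) (x e : R) :
  {ae lebesgue_measure, forall t : R, P t} -> 0 < e ->
  exists2 t, x < t < x + e & P t.
Proof.
move=> [Z [mZ Z0 sZ]] e0; apply: contrapT => nP.
have : (lebesgue_measure (`]x, (x + e)%R[ : set R) <= lebesgue_measure Z)%E.
  apply: le_measure; rewrite ?inE // => t /=; rewrite in_itv /= => xt.
  by apply: sZ => /= Pt; apply: nP; exists t.
rewrite [X in (_ <= X)%E]Z0 lebesgue_measure_itv /= lte_fin ltrDl e0.
rewrite -EFinB lee_fin; lra.
Qed.

(** * Functions moving towards their weighted mean *)

Lemma continuous_sum (R : realType) (I : finType) (f : I -> R -> R) :
  (forall i, continuous (f i)) -> continuous (fun x => \sum_i f i x).
Proof.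
by move=> cf x; apply: cvg_big => [|i _]; [exact: add_continuous|exact: cf].
Qed.

(** [tau] is the supremum of the points of [[s, t]] with [f <= c]; a value below [c] there would
    force a later crossing. *)
Lemma last_crossing (R : realType) (f : R -> R) (s t c : R) :
  s <= t -> continuous f -> f s <= c -> c < f t ->
  exists tau, [/\ s <= tau, tau < t, f tau = c &
    forall x, tau < x -> x <= t -> c < f x].
Proof.
move=> st cf fs ft.
pose E := [set x | s <= x <= t /\ f x <= c].
have Es : E s by split => //; rewrite lexx st.
have ubE : has_ubound E by exists t => x [/andP[]].
pose tau := sup E.
have stau : s <= tau by exact: ub_le_sup.
have taut : tau <= t by apply: ge_sup; [exists s|move=> x [/andP[]]].
have above x : tau < x -> x <= t -> c < f x.
  move=> tx xt; rewrite ltNge; apply/negP => fx.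
  have : E x by split => //; rewrite xt andbT; lra.
  by move=> /(ub_le_sup ubE); rewrite -/tau leNgt tx.
have ftau : f tau <= c.
  rewrite leNgt; apply/negP => cft.
  have e0 : 0 < f tau - c by rewrite subr_gt0.
  have /cvgrPdist_lt/(_ _ e0)/nbhs_ballP[r /= r0 Hr] := cf tau.
  have [x Ex xtau] := sup_adherent r0 (conj (ex_intro _ s Es) ubE).
  have xt : x <= tau by exact: ub_le_sup.
  have := Hr x; rewrite /ball /= ltr_norml => /(_ _)/ltr_normlP[|_].
    by apply/andP; split; rewrite -/tau in xtau; lra.
  by have [_] := Ex; lra.
have ltt : tau < t.
  by rewrite lt_neqAle taut andbT; apply: contraTneq ft => <-; rewrite -leNgt.
exists tau; split => //; apply/eqP; rewrite eq_le ftau /= leNgt; apply/negP => fc.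
have mm : Num.min (f tau) (f t) <= c <= Num.max (f tau) (f t).
  by rewrite ge_min le_max ftau (ltW ft) orbT.
have [x] := IVT taut (continuous_subspaceT cf) mm.
rewrite in_itv /= => /andP[tx xt] fx.
have : c < f x.
  apply: above => //; rewrite lt_neqAle tx andbT.
  by apply: contraTneq fc => ->; rewrite fx ltxx.
by rewrite fx ltxx.
Qed.

Section Consensus.
Context (R : realType) (m : nat) (w : 'I_m -> R).

Definition wavg (d : 'I_m -> R -> R) (t : R) : R := \sum_i w i * d i t.

(** Derivative-free form of a motion towards the mean: monotonicity is asked only while a component
    stays strictly on one side of it. *)
Definition moves_to_avg (d : 'I_m -> R -> R) : Prop :=
  [/\ forall i, continuous (d i),
      forall i s t, 0 <= s -> s <= t ->
        (forall x, s <= x <= t -> wavg d x < d i x) -> d i t <= d i s &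
      forall i s t, 0 <= s -> s <= t ->
        (forall x, s <= x <= t -> d i x < wavg d x) -> d i s <= d i t].

Hypotheses (w_gt0 : forall i, 0 < w i) (w_sum : \sum_i w i = 1).

Lemma wavgN d t : wavg (fun i x => - d i x) t = - wavg d t.
Proof. by rewrite /wavg -sumrN; apply: eq_bigr => i _; rewrite mulrN. Qed.

Lemma moves_to_avgN d : moves_to_avg d -> moves_to_avg (fun i x => - d i x).
Proof.
move=> [cd up lo]; split.
- by move=> i x; apply: cvgN; exact: cd.
- by move=> i s t s0 st H; rewrite lerN2; apply: lo => // x /H; rewrite wavgN ltrN2.
- by move=> i s t s0 st H; rewrite lerN2; apply: up => // x /H; rewrite wavgN ltrN2.
Qed.

(** [c - wavg d t] is the weighted sum of the nonnegative gaps [c - d k t]; all terms but one are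
    dropped. *)
Lemma wavg_gap d t c i : (forall k, d k t <= c) -> w i * (c - d i t) <= c - wavg d t.
Proof.
move=> H.
have -> : c - wavg d t = \sum_k w k * (c - d k t).
  rewrite -[c in LHS]mul1r -w_sum mulr_suml /wavg -sumrB.
  by apply: eq_bigr => k _; rewrite mulrBr.
rewrite (bigD1 i) //= lerDl sumr_ge0 // => k _.
by rewrite mulr_ge0 ?subr_ge0 // ltW.
Qed.

Lemma wavg_le d t c (i0 : 'I_m) : (forall k, d k t <= c) -> wavg d t <= c.
Proof.
move=> H; have := wavg_gap d t c i0 H.
have : 0 <= w i0 * (c - d i0 t) by rewrite mulr_ge0 ?subr_ge0 // ltW.
lra.
Qed.

Lemma continuous_wavg d : (forall i, continuous (d i)) -> continuous (wavg d).
Proof.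
by move=> cd; apply: continuous_sum => i x; apply: cvgM; [exact: cvg_cst|exact: cd].
Qed.

Definition at_rest (d : 'I_m -> R -> R) (t : R) := forall i k, d i t = d k t.

(** After its last crossing of [c] the component would lie above the mean, so it could not have
    risen. *)
Lemma le_barrier d s t c i : moves_to_avg d -> 0 <= s -> s <= t ->
  (forall x, s <= x <= t -> wavg d x < c) -> d i s <= c -> d i t <= c.
Proof.
move=> [cd up _] s0 st H ds; rewrite leNgt; apply/negP => ct.
have [x [sx xt dx Hx]] := last_crossing R (d i) s t c st (cd i) ds ct.
suff : d i t <= d i x by rewrite dx leNgt ct.
apply: up; [lra|lra|move=> y /andP[xy yt]].
apply: (@lt_le_trans _ _ c); first by apply: H; rewrite yt andbT; lra.
have [<-|nxy] := eqVneq x y; first by rewrite dx.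
by apply/ltW/Hx => //; rewrite lt_neqAle nxy.
Qed.

(** By [le_barrier], only a mean reaching [c] could let a component pass [c]. At the first such time
    all components are still at most [c], hence all equal to [c], which is a state of rest. *)
Lemma upper_bound d s t c : moves_to_avg d -> 0 <= s -> s <= t ->
  (forall x, s <= x <= t -> ~ at_rest d x) ->
  (forall i, d i s <= c) -> forall i, d i t <= c.
Proof.
move=> md s0 st nr ds i; have [cd _ _] := md.
have rest x : (forall k, d k x <= c) -> c <= wavg d x -> at_rest d x.
  move=> Hd Ha; suff E k : d k x = c by move=> j k; rewrite !E.
  apply/eqP; rewrite eq_le Hd /=.
  have h := wavg_gap d x c k Hd.
  rewrite -subr_le0 -(pmulr_rle0 _ (w_gt0 k)); lra.
have as_ : wavg d s < c.
  rewrite ltNge; apply/negP => /(rest _ ds); apply: nr; rewrite lexx st //.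
apply: (le_barrier d s t c i md s0 st) => // x /andP[sx xt].
rewrite ltNge; apply/negP => cx.
(* Time reversal turns the last crossing into the first time [- y] at which the mean equals [c]. *)
have [||||y [xy ys fy Hy]] :=
    last_crossing R (fun y => - wavg d (- y)) (- x) (- s) (- c).
- by rewrite lerN2.
- move=> y; apply: cvgN; apply: (@continuous_comp _ _ _ -%R (wavg d)).
    exact: opp_continuous.
  exact: continuous_wavg.
- by rewrite opprK lerN2.
- by rewrite opprK ltrN2.
have fy' : wavg d (- y) = c by lra.
apply: (nr (- y)); first by apply/andP; split; lra.
apply: rest; last by rewrite fy'.
move=> k; apply/ler_addgt0Pr => e e0.
apply: (le_barrier d s (- y) (c + e) k md s0); first lra.
  move=> z /andP[sz zy]; suff : wavg d z <= c by lra.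
  have [->|nzy] := eqVneq z (- y); first by rewrite fy'.
  have := Hy (- z); rewrite opprK ltrN2 => h; apply/ltW/h; last by rewrite lerN2.
  by rewrite ltrNr lt_neqAle nzy.
by have := ds k; lra.
Qed.

Lemma lower_bound d s t c : moves_to_avg d -> 0 <= s -> s <= t ->
  (forall x, s <= x <= t -> ~ at_rest d x) ->
  (forall i, c <= d i s) -> forall i, c <= d i t.
Proof.
move=> md s0 st nr ds i; rewrite -lerN2.
apply: (upper_bound _ s t (- c) (moves_to_avgN d md)) => // [x xst H|k].
  by apply: (nr x xst) => j k; apply: oppr_inj; exact: H.
by rewrite lerN2.
Qed.

(** If rest were lost, then just after the last zero of the disagreement [f] the components would
    lie in an arbitrarily narrow band, and [upper_bound] and [lower_bound] would keep them in it. *)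
Lemma at_rest_absorbing d s t : moves_to_avg d -> 0 <= s -> s <= t ->
  at_rest d s -> at_rest d t.
Proof.
move=> md s0 st ds; have [cd _ _] := md.
pose f x := \sum_i \sum_k `|d i x - d k x|.
have f_ge i k x : `|d i x - d k x| <= f x.
  rewrite /f (bigD1 i) //= (bigD1 k) //= -addrA lerDl addr_ge0 ?sumr_ge0 // => j _.
  by rewrite sumr_ge0.
have cf : continuous f.
  apply: continuous_sum => i; apply: continuous_sum => k x.
  by apply: cvg_norm; apply: cvgB; exact: cd.
have f_rest x : f x <= 0 -> at_rest d x.
  move=> fx i k; apply/eqP; rewrite -subr_eq0 -normr_le0.
  exact: le_trans (f_ge i k x) fx.
have fs : f s <= 0.
  rewrite /f big1 // => i _; rewrite big1 // => k _.
  by rewrite (ds i k) subrr normr0.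
apply: f_rest; rewrite leNgt; apply/negP => ft.
have [tau [stau taut ftau Hf]] := last_crossing R f s t 0 st cf fs ft.
suff : at_rest d t.
  move=> dt; move: ft; rewrite /f big1 ?ltxx // => i _.
  by rewrite big1 // => k _; rewrite (dt i k) subrr normr0.
suff H (i k : 'I_m) e : 0 < e -> d i t - d k t <= e.
  move=> i k; apply/eqP; rewrite eq_le -[X in X && _]subr_le0 -[X in _ && X]subr_le0.
  by apply/andP; split; apply/ler_addgt0Pr => e e0; rewrite add0r; exact: H.
move=> e0; have e20 : 0 < e / 2 by lra.
have /cvgrPdist_lt/(_ _ e20)/nbhs_ballP[r /= r0 Hr] := cf tau.
pose x := Num.min t (tau + r / 2).
have x1 : tau < x by rewrite lt_min taut /=; lra.
have x2 : x <= t by rewrite ge_min lexx.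
have x3 : x <= tau + r / 2 by rewrite ge_min lexx orbT.
have fx : f x < e / 2.
  have := Hr x; rewrite /ball /= ftau sub0r normrN => h.
  apply: le_lt_trans (ler_norm _) (h _).
  by rewrite ltr_norml; apply/andP; split; lra.
have nr y : x <= y <= t -> ~ at_rest d y.
  move=> /andP[xy yt] dy; have : 0 < f y by apply: Hf => //; lra.
  rewrite /f big1 ?ltxx // => j _.
  by rewrite big1 // => l _; rewrite (dy j l) subrr normr0.
have up : d i t <= d k x + e / 2.
  apply: (upper_bound d x t) => // [|j]; first lra.
  have := f_ge j k x; have := ler_norm (d j x - d k x); lra.
have lo : d k x - e / 2 <= d k t.
  apply: (lower_bound d x t) => // [|j]; first lra.
  have := f_ge k j x; have := ler_norm (d k x - d j x); lra.
lra.
Qed.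

Definition spread_le (d : 'I_m -> R -> R) (t c : R) : Prop :=
  exists lo hi, hi - lo <= c /\ forall i, lo <= d i t <= hi.

Lemma not_at_rest_before d s t : moves_to_avg d -> 0 <= s -> s <= t -> ~ at_rest d t ->
  forall x, s <= x <= t -> ~ at_rest d x.
Proof.
move=> md s0 st nr x /andP[sx xt] rx; apply: nr.
by apply: (at_rest_absorbing d x t) => //; lra.
Qed.

Lemma spread_at_rest d t c (i0 : 'I_m) : 0 <= c -> at_rest d t -> spread_le d t c.
Proof.
move=> c0 r; exists (d i0 t), (d i0 t); rewrite subrr; split => // i.
by rewrite (r i i0) lexx.
Qed.

Lemma spread_ge0 d t c (i0 : 'I_m) : spread_le d t c -> 0 <= c.
Proof. by move=> [lo [hi [h /(_ i0) /andP[? ?]]]]; lra. Qed.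

Lemma spread_nonincr d s t c (i0 : 'I_m) : moves_to_avg d -> 0 <= s -> s <= t ->
  spread_le d s c -> spread_le d t c.
Proof.
move=> md s0 st sp; have c0 := spread_ge0 d s c i0 sp.
have [r|nr] := pselect (at_rest d t); first exact: spread_at_rest.
have nr' := not_at_rest_before d s t md s0 st nr.
have [lo [hi [h H]]] := sp; exists lo, hi; split => // i; apply/andP; split.
- by apply: (lower_bound d s t) => // k; have /andP[] := H k.
- by apply: (upper_bound d s t) => // k; have /andP[] := H k.
Qed.

(* Either the maximum drops by [p / (1 + p)] of the spread, or the average gets
   so close to the maximum that all components do. *)
Lemma spread_contract d s t c (p : R) (i0 : 'I_m) :
  moves_to_avg d -> 0 <= s -> s <= t -> 0 < p -> (forall i, p <= w i) ->
  (forall i, exists2 x, s <= x <= t & d i x <= wavg d x) ->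
  spread_le d s c -> spread_le d t ((1 + p)^-1 * c).
Proof.
move=> md s0 st p0 pw touch sp; have c0 := spread_ge0 d s c i0 sp.
have q0 : 0 < (1 + p)^-1 by rewrite invr_gt0; lra.
have [r|nr] := pselect (at_rest d t).
  by apply: spread_at_rest => //; rewrite mulr_ge0 // ltW.
have nr' := not_at_rest_before d s t md s0 st nr.
have [lo [hi [h H]]] := sp.
have up x : s <= x <= t -> forall i, d i x <= hi.
  move=> /andP[sx xt]; apply: (upper_bound d s x) => // [y /andP[sy yx]|i].
    by apply: nr'; rewrite sy; lra.
  by have /andP[] := H i.
have low i : lo <= d i t.
  by apply: (lower_bound d s t) => // k; have /andP[] := H k.
have tt : s <= t <= t by rewrite st lexx.
(* Chosen so that [c - e = e / p]: both cases then give the same new spread. *)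
pose e := p * ((1 + p)^-1 * c).
have eE : c - e = (1 + p)^-1 * c by rewrite /e; field; lra.
have [small|] := pselect (forall i, d i t <= hi - e).
  exists lo, (hi - e); split; first by lra.
  by move=> i; rewrite low small.
move=> /existsNP[j /negP]; rewrite -ltNge => dj.
(* Component [j] is at or below the mean at some time; had the mean stayed under [hi - e], the
   component would be trapped there too. *)
have [x xst ax] : exists2 x, s <= x <= t & hi - e <= wavg d x.
  apply: contrapT => nx.
  have [y /andP[sy yt] dy] := touch j.
  have ae x : s <= x <= t -> wavg d x < hi - e.
    by move=> xst; rewrite ltNge; apply/negP => ?; apply: nx; exists x.
  suff : d j t <= hi - e by rewrite leNgt dj.
  apply: (le_barrier d y t (hi - e) j md) => //; first lra.
    by move=> z /andP[yz zt]; apply: ae; rewrite zt andbT; lra.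
  apply: (le_trans dy); apply/ltW/ae; rewrite sy yt //.
have /andP[sx xt] := xst.
exists (hi - (1 + p)^-1 * c), hi; split; first lra.
move=> i; rewrite up // andbT.
apply: (lower_bound d x t) => // [|y /andP[xy yt]|k]; first lra.
  by apply: nr'; rewrite yt andbT; lra.
have g := wavg_gap d x hi k (up x xst).
have : p * (hi - d k x) <= e.
  apply: (@le_trans _ _ (w k * (hi - d k x))); last lra.
  by rewrite ler_wpM2r // subr_ge0 up.
rewrite /e ler_pM2l //; lra.
Qed.

End Consensus.

(** * Evolution in a simplex *)

Lemma Tperiodic_natmul (R : realType) X (T : R) (f : R -> X) n t :
  Tperiodic T f -> f (t + n%:R * T) = f t.
Proof.
move=> per; elim: n => [|n IH]; first by rewrite mul0r addr0.
by rewrite -natr1 mulrDl mul1r addrA per.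
Qed.

Lemma Tperiodic_bound (R : realType) (T c : R) (f : R -> R) :
  0 < T -> Tperiodic T f -> (forall t, 0 <= t <= T -> f t <= c) ->
  forall t, 0 <= t -> f t <= c.
Proof.
move=> T0 per H t t0.
pose n := Num.truncn (t / T).
have /andP[n1 n2] : n%:R <= t / T < n.+1%:R.
  by apply: truncn_itv; rewrite divr_ge0 // ltW.
rewrite ler_pdivlMr // in n1; rewrite ltr_pdivrMr // -natr1 mulrDl mul1r in n2.
have -> : f t = f (t - n%:R * T) by rewrite -[in LHS](subrK (n%:R * T) t) Tperiodic_natmul.
by apply: H; apply/andP; split; lra.
Qed.

Section Evolution.
Context (R : realType) (m : nat) (a cm cp u : 'I_m -> R) (G h : 'I_m -> R -> R).

(* The last two fields are the flow rule [p' \in N_C(s)] integrated over time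
   intervals; unlike the pointwise rule, they pass to time translates without
   any measure theory. *)
Record evolution (s p : 'I_m -> R -> R) : Prop := Evolution {
  evo_cs : forall i, continuous (s i);
  evo_cp : forall i, continuous (p i);
  evo_box : forall i t, 0 <= t -> cm i <= s i t <= cp i;
  evo_bal : forall t, 0 <= t -> \sum_i u i * (s i t + h i t) = 0;
  evo_geo : forall t, 0 <= t ->
    exists b, forall i, s i t / a i + p i t = G i t + b * u i;
  evo_up : forall i x y, 0 <= x -> x <= y ->
    (forall t, x <= t <= y -> cm i < s i t) -> p i x <= p i y;
  evo_dn : forall i x y, 0 <= x -> x <= y ->
    (forall t, x <= t <= y -> s i t < cp i) -> p i y <= p i x }.

Hypotheses (a_gt0 : forall i, 0 < a i) (cm_lt_cp : forall i, cm i < cp i)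
  (u_neq0 : forall i, u i != 0).

(** With weights proportional to [a i * u i ^+ 2], the balance equation makes the weighted mean of
    [(s1 i - s2 i) / (a i * u i)] vanish. *)
Definition stiff (i : 'I_m) : R := a i * u i ^+ 2.
Definition weight (i : 'I_m) : R := stiff i / \sum_k stiff k.
Definition slip_gap (p1 p2 : 'I_m -> R -> R) (i : 'I_m) (t : R) : R :=
  (p1 i t - p2 i t) / u i.

Lemma stiff_gt0 i : 0 < stiff i.
Proof. by rewrite mulr_gt0 // lt0r sqr_ge0 sqrf_eq0 u_neq0. Qed.

Lemma stiff_sum_gt0 (i0 : 'I_m) : 0 < \sum_k stiff k.
Proof.
rewrite (bigD1 i0) //= ltr_pwDl ?stiff_gt0 // sumr_ge0 // => k _.
exact: ltW (stiff_gt0 k).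
Qed.

Lemma weight_gt0 i : 0 < weight i.
Proof. by rewrite divr_gt0 ?stiff_gt0 ?(stiff_sum_gt0 i). Qed.

Lemma weight_sum (i0 : 'I_m) : \sum_i weight i = 1.
Proof. by rewrite -mulr_suml divff // gt_eqF // (stiff_sum_gt0 i0). Qed.

(** Subtracting the two compatibility equations writes the gap as [b1 - b2] minus an elastic term of
    weighted mean zero, so the mean is [b1 - b2]. *)
Lemma slip_gapE s1 p1 s2 p2 t i : evolution s1 p1 -> evolution s2 p2 -> 0 <= t ->
  wavg R m weight (slip_gap p1 p2) t - slip_gap p1 p2 i t
    = (s1 i t - s2 i t) / (a i * u i).
Proof.
move=> E1 E2 t0.
have [b1 H1] := evo_geo _ _ E1 t t0; have [b2 H2] := evo_geo _ _ E2 t t0.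
have K k : slip_gap p1 p2 k t = b1 - b2 - (s1 k t - s2 k t) / (a k * u k).
  rewrite /slip_gap (_ : p1 k t - p2 k t =
    (b1 - b2) * u k - (s1 k t / a k - s2 k t / a k)).
    by field; rewrite u_neq0 gt_eqF.
  by have := H1 k; have := H2 k; lra.
have W : wavg R m weight (slip_gap p1 p2) t = b1 - b2.
  rewrite /wavg; under eq_bigr => k _ do rewrite K mulrBr.
  rewrite sumrB -mulr_suml (weight_sum i) mul1r.
  suff -> : \sum_k weight k * ((s1 k t - s2 k t) / (a k * u k)) = 0 by rewrite subr0.
  have -> : \sum_k weight k * ((s1 k t - s2 k t) / (a k * u k)) =
     (\sum_k u k * (s1 k t + h k t) - \sum_k u k * (s2 k t + h k t)) / \sum_k stiff k.
    rewrite -sumrB mulr_suml; apply: eq_bigr => k _.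
    have := lt0r_neq0 (stiff_sum_gt0 i); rewrite /weight.
    set S := \sum_k _ => S0; rewrite /stiff; field.
    by rewrite S0 u_neq0 gt_eqF.
  by rewrite (evo_bal _ _ E1) // (evo_bal _ _ E2) // subrr mul0r.
by rewrite W K; lra.
Qed.

(** A gap above the mean fixes the sign of [s1 i - s2 i]. The larger stress is then off the lower
    limit and the smaller one off the upper limit, so each plastic strain can move in one direction
    only. *)
Lemma slip_gap_nonincr s1 p1 s2 p2 i x y : evolution s1 p1 -> evolution s2 p2 ->
  0 <= x -> x <= y ->
  (forall t, x <= t <= y ->
     wavg R m weight (slip_gap p1 p2) t < slip_gap p1 p2 i t) ->
  slip_gap p1 p2 i y <= slip_gap p1 p2 i x.
Proof.
move=> E1 E2 x0 xy H.
have D t : x <= t <= y -> (s1 i t - s2 i t) / (a i * u i) < 0.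
  move=> xt; rewrite -(slip_gapE _ p1 _ p2) //; last by case/andP: xt; lra.
  by have := H t xt; lra.
have box1 t : x <= t <= y -> cm i <= s1 i t <= cp i.
  by move=> /andP[? ?]; apply: (evo_box _ _ E1); lra.
have box2 t : x <= t <= y -> cm i <= s2 i t <= cp i.
  by move=> /andP[? ?]; apply: (evo_box _ _ E2); lra.
have [ui|ui|ui] := ltgtP (u i) 0; last by have := u_neq0 i; rewrite ui eqxx.
- have S t : x <= t <= y -> s2 i t < s1 i t.
    by move=> /D; rewrite nmulr_llt0 ?subr_gt0 // invr_lt0 pmulr_rlt0.
  rewrite ler_ndivrMr // divfK ?u_neq0 //; rewrite lerB //.
    apply: (evo_up _ _ E1) => // t xt.
    by have := S t xt; have /andP[] := box2 t xt; lra.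
  apply: (evo_dn _ _ E2) => // t xt.
  by have := S t xt; have /andP[] := box1 t xt; lra.
- have S t : x <= t <= y -> s1 i t < s2 i t.
    move=> /D; rewrite pmulr_llt0 ?subr_lt0 //.
    by rewrite invr_gt0 mulr_gt0.
  rewrite ler_pdivrMr // divfK ?u_neq0 //; rewrite lerB //.
    apply: (evo_dn _ _ E1) => // t xt.
    by have := S t xt; have /andP[] := box2 t xt; lra.
  apply: (evo_up _ _ E2) => // t xt.
  by have := S t xt; have /andP[] := box1 t xt; lra.
Qed.

Lemma slip_gap_moves s1 p1 s2 p2 : evolution s1 p1 -> evolution s2 p2 ->
  moves_to_avg R m weight (slip_gap p1 p2).
Proof.
move=> E1 E2.
have sw i t : slip_gap p1 p2 i t = - slip_gap p2 p1 i t.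
  by rewrite /slip_gap -mulNr opprB.
have swa t : wavg R m weight (slip_gap p1 p2) t = - wavg R m weight (slip_gap p2 p1) t.
  by rewrite /wavg -sumrN; apply: eq_bigr => i _; rewrite sw mulrN.
split.
- move=> i x; apply: cvgMl; apply: cvgB; first exact: (evo_cp _ _ E1).
  exact: (evo_cp _ _ E2).
- by move=> i x y x0 xy H; exact: (slip_gap_nonincr s1 _ s2).
- move=> i x y x0 xy H; rewrite !sw lerN2.
  apply: (slip_gap_nonincr s2 _ s1) => // t /H.
  by rewrite sw swa ltrN2.
Qed.

Definition width : R := \sum_i (cp i - cm i) / (a i * `|u i|).

Lemma width_ge i : (cp i - cm i) / (a i * `|u i|) <= width.
Proof.
rewrite /width (bigD1 i) //= lerDl sumr_ge0 // => k _.
by rewrite divr_ge0 ?mulr_ge0 ?subr_ge0 // ltW.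
Qed.

Lemma box_dist i x y : cm i <= x <= cp i -> cm i <= y <= cp i ->
  `|(x - y) / (a i * u i)| <= width.
Proof.
move=> /andP[x1 x2] /andP[y1 y2]; apply: le_trans (width_ge i).
rewrite normrM normfV normrM (gtr0_norm (a_gt0 i)) ler_pM2r.
  by rewrite ler_norml; apply/andP; split; lra.
by rewrite invr_gt0 mulr_gt0 // normr_gt0.
Qed.

(** The bound depends neither on the solutions nor on the time, which later makes the attraction
    uniform. *)
Lemma spread_init s1 p1 s2 p2 t : evolution s1 p1 -> evolution s2 p2 -> 0 <= t ->
  spread_le R m (slip_gap p1 p2) t (width + width).
Proof.
move=> E1 E2 t0; pose A := wavg R m weight (slip_gap p1 p2) t.
exists (A - width), (A + width); split; first lra.
move=> i; have := slip_gapE _ _ _ _ t i E1 E2 t0; rewrite -/A => e.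
have := box_dist i _ _ (evo_box _ _ E1 i t t0) (evo_box _ _ E2 i t t0).
rewrite -e ler_norml => /andP[? ?]; apply/andP; split; lra.
Qed.

Lemma spread_stress s1 p1 s2 p2 t c i : evolution s1 p1 -> evolution s2 p2 -> 0 <= t ->
  spread_le R m (slip_gap p1 p2) t c -> `|s1 i t - s2 i t| <= a i * `|u i| * c.
Proof.
move=> E1 E2 t0 [lo [hi [hc H]]]; pose A := wavg R m weight (slip_gap p1 p2) t.
have Ahi : A <= hi.
  apply: (wavg_le R m weight weight_gt0 (weight_sum i)) => // k.
  by have /andP[] := H k.
have Alo : lo <= A.
  rewrite -lerN2 /A -wavgN.
  apply: (wavg_le R m weight weight_gt0 (weight_sum i)) => // k.
  by rewrite lerN2; have /andP[] := H k.
have := slip_gapE _ _ _ _ t i E1 E2 t0; rewrite -/A => e.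
have -> : s1 i t - s2 i t = (a i * u i) * (A - slip_gap p1 p2 i t).
  by rewrite e mulrC divfK // mulf_neq0 // gt_eqF.
rewrite !normrM (gtr0_norm (a_gt0 i)) ler_wpM2l ?mulr_ge0 ?(ltW (a_gt0 i)) //.
by have /andP[? ?] := H i; rewrite ler_norml; apply/andP; split; lra.
Qed.

(** The vertex of the box that maximizes the scalar product with [u]. *)
Definition corner (i : 'I_m) : R := if 0 < u i then cp i else cm i.

Lemma corner_ge0 i x : cm i <= x <= cp i -> 0 <= u i * (corner i - x).
Proof.
rewrite /corner => /andP[x1 x2]; case: ltP => ui.
  by rewrite mulr_ge0 ?subr_ge0 // ltW.
by rewrite mulr_le0 // subr_le0.
Qed.

(* By the balance equation, the stresses lie in the simplex
   [u i * (corner i - s i) >= 0], [\sum_i u i * (corner i - s i) = const]; the bound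
   on the constant says that the remaining faces of the box meet it at most in
   a vertex. *)
Hypothesis simplex : forall j t, 0 <= t ->
  \sum_i u i * (corner i + h i t) <= `|u j| * (cp j - cm j).

(** By balance, the nonnegative slacks [u k * (corner k - s k t)] add up to the sum bounded in
    [simplex]. A positive slack at [j] leaves strictly less for [i], so [s i] is off the limit
    opposite to [corner i]. *)
Lemma off_facet s p i j t : evolution s p -> 0 <= t -> i != j -> s j t <> corner j ->
  u i * (corner i - s i t) < `|u i| * (cp i - cm i).
Proof.
move=> E t0 ij sj; apply: lt_le_trans (simplex i t t0).
have -> : \sum_k u k * (corner k + h k t) = \sum_k u k * (corner k - s k t).
  rewrite -[RHS]addr0 -[X in _ = _ + X](evo_bal _ _ E t t0) -big_split /=.
  by apply: eq_bigr => k _; ring.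
rewrite (bigD1 i) //= ltrDl (bigD1 j) 1?eq_sym //=.
have pos k : 0 <= u k * (corner k - s k t).
  exact/corner_ge0/(evo_box _ _ E).
rewrite ltr_pwDl // ?sumr_ge0 //.
rewrite lt0r pos mulf_neq0 ?u_neq0 // subr_eq0.
by apply/eqP => /esym.
Qed.

(** Off facet [j], [p j / u j] can only decrease, and by [off_facet] every other [p i / u i] can
    only increase. *)
Lemma slip_order s p i j x y : evolution s p -> 0 <= x -> x <= y ->
  (forall t, x <= t <= y -> s j t <> corner j) ->
  p i x / u i - p j x / u j <= p i y / u i - p j y / u j.
Proof.
move=> E x0 xy H.
have [->|ij] := eqVneq i j; first by rewrite !subrr.
have Hj : p j y / u j <= p j x / u j.
  have [uj|uj|uj] := ltgtP (u j) 0; last by have := u_neq0 j; rewrite uj eqxx.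
  - rewrite ler_ndivrMr // divfK ?u_neq0 //; apply: (evo_up _ _ E) => // t xt.
    have t0 : 0 <= t by case/andP: xt; lra.
    have /andP[h1 _] := evo_box _ _ E j t t0.
    rewrite lt_neqAle h1 andbT; apply/eqP => e; apply: (H t xt).
    by rewrite /corner ltNge (ltW uj).
  - rewrite ler_pdivrMr // divfK ?u_neq0 //; apply: (evo_dn _ _ E) => // t xt.
    have t0 : 0 <= t by case/andP: xt; lra.
    have /andP[_ h1] := evo_box _ _ E j t t0.
    rewrite lt_neqAle h1 andbT; apply/eqP => e; apply: (H t xt).
    by rewrite /corner uj.
suff Hi : p i x / u i <= p i y / u i by lra.
have F t : x <= t <= y -> u i * (corner i - s i t) < `|u i| * (cp i - cm i).
  move=> xt; apply: (off_facet s p i j) => //; last exact: H.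
  by case/andP: xt; lra.
have [ui|ui|ui] := ltgtP (u i) 0; last by have := u_neq0 i; rewrite ui eqxx.
- rewrite ler_ndivlMr // divfK ?u_neq0 //; apply: (evo_dn _ _ E) => // t /F.
  rewrite /corner (ltNge 0 (u i)) (ltW ui) /= ltr0_norm // mulNr -mulrN ltr_nM2l //; lra.
- rewrite ler_pdivlMr // divfK ?u_neq0 //; apply: (evo_up _ _ E) => // t /F.
  rewrite /corner ui gtr0_norm // ltr_pM2l //; lra.
Qed.

(** * Periodic loads: visits to the facets and uniform attraction *)

Context (T t1 t2 eta : R).
Hypotheses (T_gt0 : 0 < T) (hT : forall i, Tperiodic T (h i))
  (GT : forall i, Tperiodic T (G i)) (t1_ge0 : 0 <= t1) (t12 : t1 < t2)
  (eta_gt0 : 0 < eta).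
(** Abstract large displacement loading: elastic strains within the box cannot follow the increment
    of [G] modulo [u], so some plastic increment exceeds [eta]. *)
Hypothesis large : forall (s1 s2 rho : 'I_m -> R) (b : R),
  (forall i, cm i <= s1 i <= cp i) -> (forall i, cm i <= s2 i <= cp i) ->
  (forall i, (s2 i - s1 i) / a i + rho i = G i t2 - G i t1 + b * u i) ->
  exists i, eta < `|rho i|.

Lemma evolution_shift s p n : evolution s p ->
  evolution (fun i t => s i (t + n%:R * T)) (fun i t => p i (t + n%:R * T)).
Proof.
move=> E; have nT : 0 <= n%:R * T by rewrite mulr_ge0 // ltW.
have sh : continuous (fun t : R => t + n%:R * T).
  by move=> t; apply: cvgD; [exact: cvg_id|exact: cvg_cst].
split.
- by move=> i t; apply: continuous_comp; [exact: sh|exact: (evo_cs _ _ E)].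
- by move=> i t; apply: continuous_comp; [exact: sh|exact: (evo_cp _ _ E)].
- by move=> i t t0; apply: (evo_box _ _ E); lra.
- move=> t t0; have t'0 : 0 <= t + n%:R * T by lra.
  rewrite -[RHS](evo_bal _ _ E _ t'0).
  by apply: eq_bigr => i _; rewrite (Tperiodic_natmul R R T (h i)).
- move=> t t0; have /(evo_geo _ _ E)[b H] : 0 <= t + n%:R * T by lra.
  by exists b => i; rewrite H (Tperiodic_natmul R R T (G i)).
- move=> i x y x0 xy H; apply: (evo_up _ _ E); [lra|lra|move=> t /andP[h1 h2]].
  by have := H (t - n%:R * T); rewrite subrK; apply; apply/andP; split; lra.
- move=> i x y x0 xy H; apply: (evo_dn _ _ E); [lra|lra|move=> t /andP[h1 h2]].
  by have := H (t - n%:R * T); rewrite subrK; apply; apply/andP; split; lra.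
Qed.

(** If facet [j] is missed during a window, the relative slips [D i] are nondecreasing with bounded
    total growth. Some block of the window then sees almost no slip, against [large]. [P] depends on
    the data only. *)
Lemma touch_facets : exists2 P, 0 < P & forall s p, evolution s p ->
  forall (n : nat) j, exists2 x, n%:R * P <= x <= n.+1%:R * P & s j x = corner j.
Proof.
(* A block of length [N%:R * T] is a multiple of the period and is long enough to contain both [t1]
   and [t2]. *)
pose N := (Num.truncn (t2 / T)).+1.
have t2N : t2 <= N%:R * T.
  rewrite -ler_pdivrMr //; apply: ltW; apply: truncnS_gt.
pose B := \sum_(i < m) (width + width).
pose U : R := \sum_(i < m) `|u i|.
(* Among [K] blocks sharing a total growth [B], one has growth at most [B / K%:R]; the factor [U]
   converts slips back to plastic strains. *)
pose K := (Num.truncn (U * B / eta)).+1.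
have B0 : 0 <= B.
  apply: sumr_ge0 => i _; rewrite addr_ge0 //; apply: le_trans (width_ge i);
  by rewrite divr_ge0 ?mulr_ge0 ?subr_ge0 // ltW.
have K0 : 0 < K%:R :> R by rewrite ltr0n.
have UK : U * (B / K%:R) <= eta.
  rewrite mulrA ler_pdivrMr // -ler_pdivrMl // mulrC; apply: ltW; exact: truncnS_gt.
pose P := (K * N)%:R * T.
exists P; first by rewrite mulr_gt0 // ltr0n muln_gt0.
move=> s p E n j; apply: contrapT => nt.
have H x : n%:R * P <= x <= n.+1%:R * P -> s j x <> corner j.
  by move=> xP sj; apply: nt; exists x.
have P0 : 0 <= n%:R * P by rewrite mulr_ge0 // mulr_ge0 // ltW.
pose tk (k : nat) := n%:R * P + k%:R * (N%:R * T).
pose D i t := p i t / u i - p j t / u j.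
have NT0 : 0 <= N%:R * T by rewrite mulr_ge0 // ltW.
have tkP k : (k <= K)%N -> n%:R * P <= tk k <= n.+1%:R * P.
  move=> kK; rewrite lerDl mulr_ge0 //= -natr1 mulrDl mul1r lerD2l /P natrM -mulrA.
  by rewrite ler_wpM2r // ler_nat.
have tkS k : tk k.+1 = tk k + N%:R * T.
  by rewrite /tk -natr1 mulrDl mul1r addrA.
have Dmono i x y : n%:R * P <= x -> x <= y -> y <= n.+1%:R * P -> D i x <= D i y.
  move=> px xy yp; apply: (slip_order s) => // [|t /andP[? ?]]; first lra.
  by apply: H; apply/andP; split; lra.
have Gtk i t k : G i (t + tk k) = G i t.
  rewrite (_ : t + tk k = t + (n * (K * N) + k * N)%N%:R * T).
    exact: Tperiodic_natmul.
  by rewrite /tk /P natrD !natrM; ring.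
(* The loads agree at both ends and the multiple of [u] cancels in [D], so only stress differences
   within the box remain. *)
have Dbound i : D i (tk K) - D i (tk 0%N) <= width + width.
  have /andP[g0 _] := tkP 0%N isT; have /andP[gK _] := tkP K (leqnn K).
  have [b0 e0] := evo_geo _ _ E (tk 0%N) (le_trans P0 g0).
  have [bK eK] := evo_geo _ _ E (tk K) (le_trans P0 gK).
  have DE b t : (forall k, s k t / a k + p k t = G k t + b * u k) ->
      D i t = G i t / u i - G j t / u j - (s i t / (a i * u i) - s j t / (a j * u j)).
    move=> e; rewrite /D.
    have -> : p i t = G i t + b * u i - s i t / a i by have := e i; lra.
    have -> : p j t = G j t + b * u j - s j t / a j by have := e j; lra.
    by field; rewrite !u_neq0 !gt_eqF.
  rewrite (DE _ _ e0) (DE _ _ eK).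
  have GG k : G k (tk K) = G k (tk 0%N) by rewrite -[tk K]add0r -[tk 0%N]add0r !Gtk.
  rewrite !GG.
  have bi k : `|(s k (tk 0%N) - s k (tk K)) / (a k * u k)| <= width.
    by apply: box_dist; apply: (evo_box _ _ E); apply: le_trans P0 _.
  have := bi i; have := bi j; rewrite !ler_norml !mulrBl => /andP[? ?] /andP[? ?]; lra.
pose F k := \sum_i D i (tk k).
have [k kK Fk] : exists2 k, (k < K)%N & F k.+1 - F k <= B / K%:R.
  apply: contrapT => nk.
  have big k : (k < K)%N -> B / K%:R < F k.+1 - F k.
    by move=> kK; rewrite ltNge; apply/negP => ?; apply: nk; exists k.
  have : \sum_(k < K) (B / K%:R) < \sum_(k < K) (F k.+1 - F k).
    apply: ltr_sum; last by move=> k _; exact: big.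
    by apply/hasP; exists ord0; rewrite ?mem_index_enum.
  rewrite sumr_const card_ord -[X in X < _]mulr_natr divfK ?gt_eqF //.
  rewrite -(big_mkord xpredT (fun k => F k.+1 - F k)) telescope_sumr //.
  rewrite ltNge => /negP; apply; rewrite /F -sumrB; apply: ler_sum => i _.
  exact: Dbound.
have /andP[k1 _] := tkP k (ltnW kK); have /andP[_ k2] := tkP k.+1 kK.
pose x := t1 + tk k; pose y := t2 + tk k.
have xk : tk k <= x by rewrite /x lerDr.
have yk : y <= tk k.+1 by rewrite /y tkS addrC lerD2l.
have xy : x <= y by rewrite /x /y lerD2r ltW.
have DD i : D i y - D i x <= B / K%:R.
  apply: le_trans Fk; rewrite /F -sumrB (bigD1 i) //=.
  have : D i y - D i x <= D i (tk k.+1) - D i (tk k).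
    have := Dmono i _ _ k1 xk (le_trans xy (le_trans yk k2)).
    have := Dmono i y (tk k.+1) (le_trans k1 (le_trans xk xy)) yk k2; lra.
  have : 0 <= \sum_(i0 < m | i0 != i) (D i0 (tk k.+1) - D i0 (tk k)).
    apply: sumr_ge0 => l _; rewrite subr_ge0; apply: Dmono => //.
    by rewrite tkS lerDl.
  lra.
have x0 : 0 <= x := le_trans P0 (le_trans k1 xk).
have y0 : 0 <= y := le_trans x0 xy.
have [bx ex] := evo_geo _ _ E x x0; have [by_ ey] := evo_geo _ _ E y y0.
(* [u i * D i] is [p i] up to a multiple of [u], which the free coefficient [b] of [large]
   absorbs. *)
have [|||i] := large (fun i => s i x) (fun i => s i y)
    (fun i => u i * (D i y - D i x)) (by_ - bx - (p j y / u j - p j x / u j)).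
- by move=> i; exact: (evo_box _ _ E).
- by move=> i; exact: (evo_box _ _ E).
- move=> i; rewrite -(Gtk i t2 k) -(Gtk i t1 k) -/x -/y.
  have -> : G i y = s i y / a i + p i y - by_ * u i by have := ey i; lra.
  have -> : G i x = s i x / a i + p i x - bx * u i by have := ex i; lra.
  by rewrite /D; field; rewrite !u_neq0 gt_eqF.
apply/negP; rewrite -leNgt normrM; apply: le_trans UK.
have D0 : 0 <= D i y - D i x.
  by rewrite subr_ge0; apply: Dmono => //; [exact: le_trans k1 xk|exact: le_trans yk k2].
rewrite (ger0_norm D0); apply: ler_pM => //.
by rewrite /U (bigD1 i) //= lerDl sumr_ge0.
Qed.

(** The spread starts below a universal bound and shrinks by the factor [r] over every window of
    length [P], so the waiting time is common to all pairs. *)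
Lemma uniform_attraction (e : R) : 0 < e -> exists t0, 0 <= t0 /\
  forall s1 p1 s2 p2, evolution s1 p1 -> evolution s2 p2 ->
    forall t i, t0 <= t -> `|s1 i t - s2 i t| <= e.
Proof.
move=> e0; have [P P0 touch] := touch_facets.
have [m0|/set0P[i0 _]] := eqVneq [set: 'I_m] set0.
  exists 0; split => // s1 p1 s2 p2 _ _ t i.
  by have : [set: 'I_m] i by []; rewrite m0.
pose q := \big[Num.min/weight i0]_i weight i.
(* The initial value [weight i0] is itself a weight, so [q] is the smallest of them. *)
have qle i : q <= weight i by rewrite /q (bigD1 i) //= ge_min lexx.
have q0 : 0 < q.
  by rewrite /q; elim/big_ind: _ => [|x y x0 y0|i _]; rewrite ?lt_min ?weight_gt0 ?x0.
pose r := (1 + q)^-1.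
have r0 : 0 < r by rewrite invr_gt0; lra.
have r1 : r < 1 by rewrite invf_lt1 //; lra.
have W0 : 0 <= width.
  by apply: sumr_ge0 => i _; rewrite divr_ge0 ?mulr_ge0 ?subr_ge0 // ltW.
pose A := \sum_i a i * `|u i|.
have A0 : 0 <= A by apply: sumr_ge0 => i _; rewrite mulr_ge0 // ltW.
pose M := A * (width + width) + 1.
have M0 : 0 < M by rewrite ltr_wpDl // mulr_ge0 // addr_ge0.
have [n Hn] : exists n, r ^+ n * M <= e.
  have : (fun n => r ^+ n) @ \oo --> (0 : R).
    by apply: cvg_expr; rewrite gtr0_norm.
  move=> /cvgrPdist_lt/(_ (e / M) (divr_gt0 e0 M0))[n _ Hn]; exists n.
  have := Hn n (leqnn n); rewrite sub0r normrN ger0_norm ?exprn_ge0 ?(ltW r0) //.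
  by rewrite ltr_pdivlMr // => /ltW.
have nP0 : 0 <= n%:R * P by rewrite mulr_ge0 // ltW.
exists (n%:R * P); split => // s1 p1 s2 p2 E1 E2 t i nt.
have mv := slip_gap_moves _ _ _ _ E1 E2.
have ws := weight_sum i0.
have sp k : spread_le R m (slip_gap p1 p2) (k%:R * P) (r ^+ k * (width + width)).
  elim: k => [|k IH].
    by rewrite mul0r expr0 mul1r; exact: spread_init E1 E2 (lexx 0).
  rewrite exprS -mulrA.
  apply: (spread_contract R m weight weight_gt0 ws _ (k%:R * P)) => //.
  - by rewrite mulr_ge0 // ltW.
  - by rewrite ler_wpM2r ?ler_nat // ltW.
  (* When the first solution visits facet [j], [(corner j - s2 j x) / u j] is nonnegative, so gap
     [j] is at most the mean. *)
  move=> j; have [x xP sx] := touch _ _ E1 k j; exists x => //.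
  have x0 : 0 <= x.
    by case/andP: xP => h1 _; apply: le_trans h1; rewrite mulr_ge0 // ltW.
  rewrite -subr_ge0 (slip_gapE _ _ _ _ x j E1 E2 x0) sx.
  have := corner_ge0 j (s2 j x) (evo_box _ _ E2 j x x0).
  have -> : (corner j - s2 j x) / (a j * u j)
      = (a j * u j ^+ 2)^-1 * (u j * (corner j - s2 j x)).
    by field; rewrite u_neq0 gt_eqF.
  by move=> ?; rewrite mulr_ge0 // invr_ge0 ltW // stiff_gt0.
have t0 : 0 <= t by lra.
have spt := spread_nonincr R m weight weight_gt0 ws _ _ _ _ i0 mv nP0 nt (sp n).
apply: le_trans (spread_stress _ _ _ _ t _ i E1 E2 t0 spt) _.
apply: le_trans Hn; rewrite mulrCA ler_pM2l ?exprn_gt0 //.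
have : a i * `|u i| * (width + width) <= A * (width + width).
  rewrite ler_wpM2r ?addr_ge0 // /A (bigD1 i) //= lerDl sumr_ge0 // => k _.
  by rewrite mulr_ge0 // ltW.
rewrite /M; lra.
Qed.

(** The translates of [s] by multiples of [T] are stresses of evolutions, hence Cauchy at each time,
    and their limit is unchanged by one more period. Any other evolution is close to all of them
    after a common time. *)
Lemma periodic_attractor s p : evolution s p ->
  exists s0 : 'I_m -> R -> R, (forall i t, 0 <= t -> s0 i (t + T) = s0 i t) /\
    forall e, 0 < e -> exists t0, forall s1 p1, evolution s1 p1 ->
      forall t i, t0 <= t -> `|s1 i t - s0 i t| <= e.
Proof.
move=> E.
pose z i t (n : nat) := s i (t + n%:R * T).
have shiftE n := evolution_shift s p n E.
have cz i t : 0 <= t -> cvgn (z i t).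
  move=> t0; apply/cauchy_cvgP/cauchy_exP => e e0.
  have e20 : 0 < e / 2 by lra.
  have [tau [tau0 H]] := uniform_attraction _ e20.
  pose N := (Num.truncn (tau / T)).+1.
  have NT : tau <= t + N%:R * T.
    have : tau < N%:R * T by rewrite -ltr_pdivrMr //; exact: truncnS_gt.
    lra.
  exists (z i t N); exists N => // n /= Nn; rewrite /ball /=.
  have := H _ _ _ _ E (shiftE (n - N)%N) (t + N%:R * T) i NT.
  rewrite -addrA -mulrDl -natrD subnKC // -/(z i t N) -/(z i t n) => h'.
  by apply: le_lt_trans h' _; lra.
exists (fun i t => limn (z i t)); split.
  move=> i t t0; apply: cvg_lim => //.
  have -> : z i (t + T) = fun n => z i t n.+1.
    by apply/funext => n; rewrite /z -natr1; congr (s i _); ring.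
  by have := cz i t t0; rewrite -(cvg_shiftS (z i t)).
move=> e e0; have [t0 [t00 H]] := uniform_attraction _ e0.
exists t0 => s1 p1 E1 t i tt0; apply/ler_addgt0Pr => d d0.
have /cvgrPdist_lt/(_ _ d0)[n _ Hn] := cz i t (le_trans t00 tt0).
have h1 := Hn n (leqnn n); have h2 := H _ _ _ _ E1 (shiftE n) t i tt0.
have -> : s1 i t - limn (z i t) = (s1 i t - z i t n) - (limn (z i t) - z i t n) by ring.
apply: le_trans (ler_normB _ _) _; apply: lerD => //; exact: ltW.
Qed.

End Evolution.

(** * Linear algebra of the network *)

Lemma sum_delta (R : realType) n (x : 'cV[R]_n) y :
  \sum_z (z == y)%:R * x z 0 = x y 0.
Proof.
rewrite (bigD1 y) //= eqxx mul1r big1 ?addr0 // => z /negbTE ->.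
by rewrite mul0r.
Qed.

Section Network.
Context (R : realType) (n m q : nat) (il jl : 'I_m -> 'I_n) (a cm cp : 'I_m -> R)
  (Il Jl : 'I_q -> 'I_n) (Rm : 'M[R]_(m, q)).
Local Notation D := (kinD R il jl).

Lemma kinDE (xi : 'cV[R]_n) k : (D *m xi) k 0 = xi (jl k) 0 - xi (il k) 0.
Proof.
rewrite mxE -(sum_delta R n xi (jl k)) -(sum_delta R n xi (il k)) -sumrB.
by apply: eq_bigr => x _; rewrite mxE mulrBl.
Qed.

Lemma dotvDr k (x y z : 'cV[R]_k) : dotv x (y + z) = dotv x y + dotv x z.
Proof. by rewrite /dotv -big_split; apply: eq_bigr => i _; rewrite mxE mulrDr. Qed.

Lemma dotvZr k (x y : 'cV[R]_k) c : dotv x (c *: y) = c * dotv x y.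
Proof. by rewrite /dotv mulr_sumr; apply: eq_bigr => i _; rewrite mxE mulrCA. Qed.

Lemma diagAE (x : 'cV[R]_m) i : (diagA a *m x) i 0 = a i * x i 0.
Proof. by rewrite /diagA mul_diag_mx !mxE. Qed.

Hypothesis a_gt0 : forall k, 0 < a k.

Lemma diagA_unit : diagA a \in unitmx.
Proof.
rewrite unitmxE det_diag unitfE; apply/prodf_neq0 => i _.
by rewrite mxE gt_eqF.
Qed.

Lemma invAE (x : 'cV[R]_m) i : (invmx (diagA a) *m x) i 0 = x i 0 / a i.
Proof.
have := diagAE (invmx (diagA a) *m x) i; rewrite mulKVmx ?diagA_unit // => ->.
by rewrite mulrAC divff ?mul1r // gt_eqF.
Qed.

Lemma dotv_diagA (x y : 'cV[R]_m) : dotv x (diagA a *m y) = \sum_i a i * x i 0 * y i 0.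
Proof. by apply: eq_bigr => i _; rewrite diagAE mulrCA mulrA. Qed.

Hypothesis chain : forall (j : 'I_q) (xi : 'cV[R]_n),
  (col j Rm)^T *m (D *m xi) = (xi (Jl j) 0 - xi (Il j) 0)%:M.

Lemma chain_eq0 (xi : 'cV[R]_n) : Rm^T *m (D *m xi) = 0 <-> forall j, xi (Jl j) 0 = xi (Il j) 0.
Proof.
have rowE j : row j (Rm^T *m (D *m xi)) = (xi (Jl j) 0 - xi (Il j) 0)%:M.
  by rewrite row_mul -chain tr_col.
split=> [H j|H].
  have := rowE j; rewrite H row0 => /matrixP/(_ 0 0).
  by rewrite !mxE /= mulr1n => /esym/subr0_eq.
by apply/row_matrixP => j; rewrite rowE H subrr row0; apply/matrixP => x y; rewrite !mxE mul0rn.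
Qed.

Hypotheses (rankRD : \rank (Rm^T *m D) = q) (nq : n = q.+2).
Context (ubar : 'cV[R]_m).
Hypotheses (Uu : inU D Rm ubar) (u_nz : ubar != 0).

(* [ker (R^T D)] has dimension [n - q = 2] and contains the constants, which [D] kills. *)
Lemma inU_line x : inU D Rm x -> exists b, x = b *: ubar.
Proof.
move=> [[xi1 x1] Rx]; have [[xi0 u0] Ru] := Uu.
pose one : 'cV[R]_n := const_mx 1.
have D1 : D *m one = 0 by apply/matrixP => k z; rewrite ord1 kinDE !mxE subrr.
pose M := Rm^T *m D; pose K := kermx M^T.
have inK (xi : 'cV[R]_n) : Rm^T *m (D *m xi) = 0 -> (xi^T <= K)%MS.
  by rewrite mulmxA => H; apply/sub_kermxP; rewrite -trmx_mul H trmx0.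
(* Displacements for [ubar] and [x] and the constant vector: three vectors in a space of dimension
   two satisfy a nontrivial relation. *)
pose W := col_mx xi0^T (col_mx xi1^T one^T).
have WK : (W <= K)%MS.
  rewrite !col_mx_sub !inK -?u0 -?x1 ?Ru ?Rx // D1 mulmx0 //.
have rW : (\rank W <= 2)%N.
  apply: (leq_trans (mxrankS WK)); rewrite mxrank_ker mxrank_tr rankRD nq.
  by rewrite -addn2 addKn.
have : kermx W != 0.
  by rewrite kermx_eq0 -row_leq_rank; apply/negP => /leq_trans/(_ rW).
rewrite -nz_row_eq0; set v := nz_row _ => v0.
have vW : v *m W = 0 by apply/sub_kermxP; exact: nz_row_sub.
have [v1 [v2 [v3 vE]]] : exists v1 v2 v3 : 'M[R]_1, v = row_mx v1 (row_mx v2 v3).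
  by exists (lsubmx v), (lsubmx (rsubmx v)), (rsubmx (rsubmx v)); rewrite !hsubmxK.
have comb : v1 0 0 *: xi0 + v2 0 0 *: xi1 + v3 0 0 *: one = 0.
  apply: trmx_inj; rewrite trmx0 -vW vE !mul_row_col addrA !linearD /= !linearZ /=.
  by rewrite {2}[v1]mx11_scalar {2}[v2]mx11_scalar {2}[v3]mx11_scalar !mul_scalar_mx.
have combD : v1 0 0 *: ubar + v2 0 0 *: x = 0.
  have := congr1 (mulmx D) comb; rewrite !mulmxDr -!scalemxAr D1 scaler0 addr0 mulmx0.
  by rewrite -u0 -x1.
have v2nz : v2 0 0 != 0.
  apply: contraNneq v0 => v20; move: combD; rewrite v20 scale0r addr0 => /eqP.
  rewrite scaler_eq0 (negbTE u_nz) orbF => /eqP v10.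
  move: comb; rewrite v20 v10 !scale0r !add0r => /matrixP.
  have i0 : 'I_n by rewrite nq; exact: ord0.
  move=> /(_ i0 0); rewrite !mxE mulr1 => v30.
  by rewrite vE [v1]mx11_scalar [v2]mx11_scalar [v3]mx11_scalar v10 v20 v30 !raddf0 !row_mx0.
exists (- (v1 0 0) / v2 0 0).
move: combD => /eqP; rewrite addrC addr_eq0 => /eqP e.
by rewrite mulrC -scalerA scaleNr -e scalerA mulVf // scale1r.
Qed.

(** The indicator [xi] of the nodes linked to [il k] by controlled pairs puts [D *m xi] in [U], with
    entry [-1] at the unblocked spring [k]; a multiple of [ubar] has this entry only if [ubar k 0]
    is nonzero. *)
Lemma ubar_neq0 : (forall k, ~~ blocked il jl Il Jl k) -> forall k, ubar k 0 != 0.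
Proof.
move=> nb k; apply/eqP => uk0.
pose xi : 'cV[R]_n := \col_x (connect (edge_rel Il Jl) (il k) x)%:R.
have edge j : edge_rel Il Jl (Il j) (Jl j) /\ edge_rel Il Jl (Jl j) (Il j).
  by split; apply/existsP; exists j; rewrite !eqxx ?orbT.
have Uxi : inU D Rm (D *m xi).
  split; first by exists xi.
  apply/chain_eq0 => j; rewrite !mxE; congr (_%:R); congr nat_of_bool.
  have [e1 e2] := edge j.
  by apply/idP/idP => h; apply: connect_trans h (connect1 _).
have [b /matrixP/(_ k 0)] := inU_line _ Uxi.
have := nb k; rewrite /blocked kinDE !mxE uk0 mulr0 connect0 => /negbTE -> /eqP.
by rewrite sub0r oppr_eq0 oner_eq0.
Qed.

(** * The energy norm and the projections onto [U] and [V] *)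

Definition energy (x : 'cV[R]_m) : R := \sum_i a i * x i 0 * x i 0.

Lemma energy_ubar_gt0 : 0 < energy ubar.
Proof.
have ge0 i : 0 <= a i * ubar i 0 * ubar i 0.
  by rewrite -mulrA -expr2 mulr_ge0 ?sqr_ge0 // ltW.
rewrite lt0r sumr_ge0 // andbT; apply: contra u_nz => /eqP e.
apply/eqP/matrixP => i z; rewrite ord1 mxE; apply/eqP.
have := psumr_eq0P (fun i _ => ge0 i) e (i := i) isT.
by move=> /eqP; rewrite -mulrA mulf_eq0 gt_eqF //= mulf_eq0 orbb.
Qed.

(** The coordinate along [ubar] of the projection orthogonal for the [A]-inner product. *)
Definition coefU (x : 'cV[R]_m) : R := dotv ubar (diagA a *m x) / energy ubar.

Lemma coefUD x y : coefU (x + y) = coefU x + coefU y.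
Proof. by rewrite /coefU mulmxDr dotvDr mulrDl. Qed.

Lemma coefUZ c x : coefU (c *: x) = c * coefU x.
Proof. by rewrite /coefU -scalemxAr dotvZr mulrA. Qed.

Lemma coefU_ubar : coefU ubar = 1.
Proof. by rewrite /coefU dotv_diagA divff // gt_eqF // energy_ubar_gt0. Qed.

Lemma dotv_coefU x : dotv ubar (diagA a *m x) = coefU x * energy ubar.
Proof. by rewrite /coefU divfK // gt_eqF // energy_ubar_gt0. Qed.

Lemma inVP x : inV a D Rm x <-> forall v, inU D Rm v -> dotv (diagA a *m x) v = 0.
Proof.
split=> [[w [Hw ->]] v|H]; first by rewrite mulKVmx ?diagA_unit //; exact: Hw.
by exists (diagA a *m x); rewrite mulKmx ?diagA_unit.
Qed.

Lemma dotvC k (x y : 'cV[R]_k) : dotv x y = dotv y x.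
Proof. by apply: eq_bigr => i _; rewrite mulrC. Qed.

(** [projU] is defined by choice, so the formula needs existence and uniqueness of the
    decomposition. *)
Lemma projUE x : projU a D Rm x = coefU x *: ubar.
Proof.
apply: xget_unique.
  split.
    have [[xi e] Re] := Uu; split; first by exists (coefU x *: xi); rewrite -scalemxAr -e.
    by rewrite -scalemxAr Re scaler0.
  apply/inVP => v /inU_line[b ->]; rewrite dotvZr dotvC.
  rewrite dotv_coefU -scaleNr coefUD coefUZ coefU_ubar.
  by rewrite mulr1 subrr mul0r mulr0.
move=> y [/inU_line[b ->] /inVP/(_ _ Uu)]; rewrite dotvC => e.
have : coefU (x - b *: ubar) = 0 by rewrite /coefU e mul0r.
by rewrite -scaleNr coefUD coefUZ coefU_ubar mulr1 => /subr0_eq ->.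
Qed.

(** Pythagoras for the [A]-inner product. *)
Lemma energy_projV x : energy (projV a D Rm x) <= energy x.
Proof.
rewrite /projV projUE.
have -> : energy x = energy (x - coefU x *: ubar) + coefU x ^+ 2 * energy ubar.
  have e : \sum_i a i * ubar i 0 * x i 0 = coefU x * energy ubar.
    by rewrite -dotv_diagA dotv_coefU.
  have -> : energy (x - coefU x *: ubar) = energy x
     - 2 * coefU x * (\sum_i a i * ubar i 0 * x i 0) + coefU x ^+ 2 * energy ubar.
    rewrite /energy !mulr_sumr -sumrB -big_split /=.
    by apply: eq_bigr => i _; rewrite !mxE; ring.
  by rewrite e; ring.
by rewrite lerDl mulr_ge0 ?sqr_ge0 // ltW // energy_ubar_gt0.
Qed.

Lemma projV_shift x y v b : v = y - x + b *: ubar ->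
  projV a D Rm v = projV a D Rm y - projV a D Rm x.
Proof.
move=> ->; rewrite /projV !projUE !coefUD coefUZ coefU_ubar mulr1.
rewrite -scaleN1r coefUZ; apply/matrixP => i z; rewrite !mxE; ring.
Qed.

Lemma normAE x : normA a x = Num.sqrt (energy x).
Proof. by rewrite /normA dotv_diagA. Qed.

(** A strict inequality survives a small enlargement of the elastic ranges; this is the room left
    for plastic increments up to [eta]. *)
Lemma energy_slack X : (forall i, cm i < cp i) ->
  energy (invmx (diagA a) *m \col_i cm i - invmx (diagA a) *m \col_i cp i) < X ->
  exists2 eta, 0 < eta & forall v : 'cV[R]_m,
    (forall i, `|v i 0| <= (cp i - cm i) / a i + eta) -> energy v < X.
Proof.
move=> cmp; set E0 := energy _ => EX.
have E0E : E0 = \sum_i a i * ((cp i - cm i) / a i) ^+ 2.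
  apply: eq_bigr => i _; set x := (_ - _ : 'cV_m).
  have -> : x i 0 = - ((cp i - cm i) / a i).
    have -> : x i 0 = (invmx (diagA a) *m \col_i cm i) i 0
      - (invmx (diagA a) *m \col_i cp i) i 0 by rewrite !mxE.
    by rewrite !invAE !mxE; ring.
  by ring.
(* For [eta <= 1], enlarging every range by [eta] raises the energy by at most [eta * B]. *)
pose B := \sum_i (2 * (cp i - cm i) + a i).
have B0 : 0 <= B.
  by apply: sumr_ge0 => i _; rewrite addr_ge0 ?mulr_ge0 ?subr_ge0 // ltW.
pose eta := Num.min 1 ((X - E0) / (2 * (B + 1))).
have eta0 : 0 < eta.
  by rewrite lt_min ltr01 /= divr_gt0 ?subr_gt0 // mulr_gt0 // ltr_wpDl.
have eta1 : eta <= 1 by rewrite ge_min lexx.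
have etaB : eta * B < X - E0.
  have : eta <= (X - E0) / (2 * (B + 1)) by rewrite ge_min lexx orbT.
  rewrite ler_pdivlMr; last by lra.
  have : 0 <= eta * B by rewrite mulr_ge0 // ltW.
  rewrite mulrCA mulrDr mulr1; lra.
exists eta => // v Hv.
apply: (@le_lt_trans _ _ (E0 + eta * B)); last by lra.
rewrite E0E /B mulr_sumr -big_split /=; apply: ler_sum => i _.
have d0 : 0 <= (cp i - cm i) / a i by rewrite divr_ge0 ?subr_ge0 // ltW.
have h : v i 0 ^+ 2 <= ((cp i - cm i) / a i + eta) ^+ 2.
  rewrite -real_normK ?num_real // ler_pXn2r ?nnegrE //; first by lra.
have -> : a i * ((cp i - cm i) / a i) ^+ 2 + eta * (2 * (cp i - cm i) + a i)
   = a i * ((cp i - cm i) / a i + eta) ^+ 2 + a i * (eta * (1 - eta)).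
  by field; rewrite gt_eqF.
have : 0 <= a i * (eta * (1 - eta)) by rewrite !mulr_ge0 ?subr_ge0 // ltW.
have := ler_wpM2l (ltW (a_gt0 i)) h; rewrite -mulrA -expr2; lra.
Qed.

End Network.

(** * From the variational system to the evolution *)

Lemma ae_impl (R : realType) (P Q : R -> Prop) :
  {ae lebesgue_measure, forall t : R, P t} -> (forall t, P t -> Q t) ->
  {ae lebesgue_measure, forall t : R, Q t}.
Proof. by move=> ae PQ; apply: negligibleS ae => t /=; apply: contra_not => /PQ. Qed.

(** Evolutions are continuous on the whole line, solutions are controlled for [t >= 0] only;
    [Num.max 0 t] freezes them before time zero. *)
Lemma abs_cont_continuous (R : realType) (f : R -> R) :
  (forall b, 0 <= b -> abs_cont_on f 0 b) -> continuous (fun t : R => f (Num.max 0 t)).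
Proof.
move=> ac x; apply/cvgrPdist_lt => e e0.
pose b := Num.max 0 x + 1.
have x0 : 0 <= Num.max 0 x by rewrite le_max lexx.
have [del del0 Hd] := ac b (addr_ge0 x0 ler01) e e0.
have H y z : 0 <= y -> y <= z -> z <= b -> z - y < del -> `|f z - f y| < e.
  move=> y0 yz zb yzd.
  have := Hd 1%N (fun=> y) (fun=> z); rewrite !big_ord_recl !big_ord0 !addr0.
  by apply => // k _; split => //; split.
have dd : 0 < Num.min 1 del by rewrite lt_min ltr01.
apply/nbhs_ballP; exists (Num.min 1 del) => // y; rewrite /ball /= lt_min ltr_norml.
move=> /andP[/andP[h1 h2]]; rewrite ltr_norml => /andP[h3 h4].
have y0 : 0 <= Num.max 0 y by rewrite le_max lexx.
have yb : Num.max 0 y <= b by rewrite ge_max /b; have := le_max x 0 x; rewrite lexx orbT; lra.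
have xb : Num.max 0 x <= b by rewrite /b; lra.
have [xy|yx] := leP x y.
- rewrite distrC; apply: H => //.
    by rewrite ge_max le_max lexx le_max xy orbT.
  rewrite ltrBlDr gt_max; have : x <= Num.max 0 x by rewrite le_max lexx orbT.
  lra.
- apply: H => //.
    by rewrite ge_max le_max lexx le_max (ltW yx) orbT.
  rewrite ltrBlDr gt_max; have : y <= Num.max 0 y by rewrite le_max lexx orbT.
  lra.
Qed.

Lemma ae_le_everywhere (R : realType) (f : R -> R) c : continuous f ->
  {ae lebesgue_measure, forall t : R, 0 <= t -> f t <= c} ->
  forall t, 0 <= t -> f t <= c.
Proof.
move=> cf ae t t0; rewrite leNgt; apply/negP => ct.
have e0 : 0 < f t - c by rewrite subr_gt0.
have /cvgrPdist_lt/(_ _ e0)/nbhs_ballP[r /= r0 Hr] := cf t.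
have [x /andP[tx xr] Px] := ae_dense R (fun t => 0 <= t -> f t <= c) t r ae r0.
have := Hr x; rewrite /ball /= ltr_norml => /(_ _)/ltr_normlP[|_ h].
  by apply/andP; split; lra.
by have := Px (le_trans t0 (ltW tx)); lra.
Qed.

Lemma ae_eq0_everywhere (R : realType) (f : R -> R) : continuous f ->
  {ae lebesgue_measure, forall t : R, 0 <= t -> f t = 0} ->
  forall t, 0 <= t -> f t = 0.
Proof.
move=> cf ae t t0; apply/eqP; rewrite -normr_le0.
apply: (ae_le_everywhere R (fun t => `|f t|)) => //.
  by move=> x; apply: cvg_norm; exact: cf.
by apply: (ae_impl _ _ _ ae) => x H /H ->; rewrite normr0.
Qed.

Lemma lipschitz_continuous (R : realType) k (f : R -> 'cV[R]_k) i :
  lipschitz_vec f -> continuous (fun t => f t i 0).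
Proof.
move=> [L H] x; apply/cvgrPdist_lt => e e0.
have M0 : 0 < `|L| + 1 by rewrite ltr_wpDl.
apply/nbhs_ballP; exists (e / (`|L| + 1)); first by rewrite /= divr_gt0.
move=> y; rewrite /ball /= ltr_pdivlMr // mulrC => h.
apply: le_lt_trans (H x y i) (le_lt_trans _ h).
by rewrite ler_wpM2r // (le_trans (ler_norm L)) // lerDl.
Qed.

(** The box is a product, so a test point may differ from [x] in one coordinate only. *)
Lemma normal_cone_coord (R : realType) m (cm cp : 'I_m -> R) (x z : 'cV[R]_m) i c :
  normal_cone cm cp x z -> cm i <= c <= cp i -> z i 0 * (c - x i 0) <= 0.
Proof.
move=> [Cx H] ci.
have := H (\col_k if k == i then c else x k 0) _.
rewrite /dotv (bigD1 i) //= !mxE eqxx big1 ?addr0.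
  apply=> k; rewrite mxE; case: ifP => [/eqP ->|_] //; exact: Cx.
by move=> k /negbTE ki; rewrite !mxE ki subrr mulr0.
Qed.

Lemma abs_cont_opp (R : realType) (f : R -> R) x y :
  abs_cont_on f x y -> abs_cont_on (fun t => - f t) x y.
Proof.
move=> ac e e0; have [del del0 H] := ac e e0; exists del => // N lo hi h1 h2 h3.
have := H N lo hi h1 h2 h3; congr (_ < _); apply: eq_bigr => k _.
by rewrite -opprD normrN.
Qed.

Section Solution.
Context (R : realType) (n m q : nat) (il jl : 'I_m -> 'I_n) (a cm cp : 'I_m -> R)
  (Il Jl : 'I_q -> 'I_n) (Rm : 'M[R]_(m, q)) (Lm : 'M[R]_(n, q))
  (l : R -> 'cV[R]_q) (hbar : R -> 'cV[R]_m) (uv : 'cV[R]_m).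
Local Notation D := (kinD R il jl).
Hypotheses (a_gt0 : forall k, 0 < a k)
  (chain : forall (j : 'I_q) (xi : 'cV[R]_n),
    (col j Rm)^T *m (D *m xi) = (xi (Jl j) 0 - xi (Il j) 0)%:M)
  (rankRD : \rank (Rm^T *m D) = q) (RDL : Rm^T *m D *m Lm = 1%:M)
  (nq : n = q.+2) (lip_l : lipschitz_vec l)
  (hbar_cont : forall i, continuous (fun t : R => hbar t i 0))
  (Uu : inU D Rm uv) (u_neq0 : forall k, uv k 0 != 0) (i0 : 'I_m).

(** The displacement loading before projection: it differs from [g] by a multiple of [uv], which
    [evo_geo] leaves free. *)
Definition disp (i : 'I_m) (t : R) : R := (D *m Lm *m l t) i 0.

Lemma disp_continuous i : continuous (disp i).
Proof.
have -> : disp i = fun t => \sum_k (D *m Lm) i k * l t k 0.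
  by apply/funext => t; rewrite /disp mxE.
apply: continuous_sum => k t; apply: cvgM; first exact: cvg_cst.
exact: lipschitz_continuous.
Qed.

(** The box, balance and compatibility relations pass from almost every time to all times by
    continuity; the flow rule is integrated by [abs_cont_ae_derive_le0]. *)
Lemma solution_evolution s e p r : solution a cm cp il jl Il Jl Rm l hbar s e p r ->
  evolution R m a cm cp (fun i => uv i 0) disp (fun i t => hbar t i 0)
    (fun i t => s (Num.max 0 t) i 0) (fun i t => p (Num.max 0 t) i 0).
Proof.
move=> [acs _ acp _ ae].
have maxE (t : R) : 0 <= t -> Num.max 0 t = t by move=> t0; apply/max_idPr.
have cs i : continuous (fun t : R => s (Num.max 0 t) i 0).
  by apply: (abs_cont_continuous R (fun t => s t i 0)) => b; exact: acs.
have cp_ i : continuous (fun t : R => p (Num.max 0 t) i 0).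
  by apply: (abs_cont_continuous R (fun t => p t i 0)) => b; exact: acp.
have u0 : uv != 0.
  by apply/eqP => uv0; have := u_neq0 i0; rewrite uv0 mxE eqxx.
have flow i c (t : R) : cm i <= c <= cp i ->
    [/\ s t = diagA a *m e t,
          ((forall i, derivable (fun x => p x i 0) t 1) /\
           normal_cone cm cp (s t) (\col_i ('D_1 (fun x => p x i 0) t))),
          in_rangeD D (e t + p t),
          Rm^T *m (e t + p t) = l t &
          \sum_(k < m) s t k 0 *: svec R il jl k + \sum_(k < q) r t k 0 *: rvec R Il Jl k
            + (- (D^T *m hbar t)) = 0] ->
    'D_1 (fun x => p x i 0) t * (c - s t i 0) <= 0.
  move=> ci [_ [_ nc] _ _ _].
  by have := normal_cone_coord R m cm cp _ _ i c nc ci; rewrite mxE.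
split => //.
- move=> i t t0; apply/andP; split.
    rewrite -lerN2; apply: (ae_le_everywhere R (fun t : R => - s (Num.max 0 t) i 0)) => //.
      by move=> x; apply: cvgN; exact: cs.
    apply: (ae_impl _ _ _ ae) => x H x0; have [_ [_ [/(_ i)/andP[h _] _]] _ _ _] := H x0.
    by rewrite maxE // lerN2.
  apply: (ae_le_everywhere R (fun t : R => s (Num.max 0 t) i 0)) => //.
  apply: (ae_impl _ _ _ ae) => x H x0; have [_ [_ [/(_ i)/andP[_ h] _]] _ _ _] := H x0.
  by rewrite maxE.
- apply: (ae_eq0_everywhere R (fun t : R => \sum_i uv i 0 * (s (Num.max 0 t) i 0 + hbar t i 0))).
    apply: continuous_sum => i x; apply: cvgM; first exact: cvg_cst.
    by apply: cvgD; [exact: cs|exact: hbar_cont].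
  apply: (ae_impl _ _ _ ae) => x H x0; have [_ _ _ _ bal] := H x0; rewrite maxE //.
  (* The nodal equation is tested with [xi], where [uv = D *m xi]; the reactions drop out because
     [Rm^T *m uv = 0]. *)
  have [[xi e1] Ru] := Uu; have Rxi : Rm^T *m (D *m xi) = 0 by rewrite -e1.
  have /(chain_eq0 _ _ _ _ il jl _ _ _ chain) JI := Rxi.
  have pick := sum_delta R n xi.
  have dsvec k : (svec R il jl k)^T *m xi = (- uv k 0)%:M.
    apply/matrixP => y z; rewrite !ord1 [RHS]mxE mulr1n e1 kinDE opprB.
    rewrite mxE -(pick (jl k)) -(pick (il k)) -sumrB.
    by apply: eq_bigr => w _; rewrite !mxE mulrBl.
  have drvec k : (rvec R Il Jl k)^T *m xi = 0.
    apply/matrixP => y z; rewrite !ord1 [RHS]mxE.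
    transitivity (xi (Il k) 0 - xi (Jl k) 0); last by rewrite JI subrr.
    rewrite mxE -(pick (Jl k)) -(pick (Il k)) -sumrB.
    by apply: eq_bigr => w _; rewrite !mxE mulrBl.
  have := congr1 (fun M => (M^T *m xi) 0 0) bal.
  rewrite trmx0 mul0mx [RHS]mxE !linearD /= linearN /= !mulmxDl mulNmx trmx_mul trmxK.
  rewrite -mulmxA -e1 !linear_sum /= !mulmx_suml.
  have tz c (v : 'cV[R]_n) : (c *: v)^T *m xi = c *: (v^T *m xi).
    by rewrite linearZ /= -scalemxAl.
  rewrite (eq_bigr (fun k => s x k 0 *: (- uv k 0)%:M)); last first.
    by move=> k _; rewrite tz dsvec.
  rewrite [X in _ + X - _]big1 ?addr0; last first.
    by move=> k _; rewrite tz drvec scaler0.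
  rewrite !mxE summxE => h; apply: oppr_inj; rewrite oppr0 -[RHS]h -sumrB -sumrN.
  by apply: eq_bigr => k _; rewrite !mxE mulr1n; ring.
- move=> t t0.
  pose f i (t : R) := s (Num.max 0 t) i 0 / a i + p (Num.max 0 t) i 0 - disp i t.
  have cf i : continuous (f i).
    move=> x; apply: cvgB; last exact: disp_continuous.
    by apply: cvgD; [apply: cvgMl; exact: cs|exact: cp_].
  (* The coefficient of [uv] is known only almost everywhere; eliminating it through [i0] leaves a
     relation between continuous functions. *)
  have F i : uv i0 0 * f i t - uv i 0 * f i0 t = 0.
    apply: (ae_eq0_everywhere R (fun t => uv i0 0 * f i t - uv i 0 * f i0 t)) => //.
      move=> x; apply: cvgB; (apply: cvgM; first exact: cvg_cst); exact: cf.
    apply: (ae_impl _ _ _ ae) => x H x0; have [se _ [xi e1] Rl _] := H x0.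
    have /(inU_line R n m q il jl Rm rankRD nq uv Uu u0)[b /matrixP eb] :
        inU D Rm (e x + p x - D *m Lm *m l x).
      split; first by exists (xi - Lm *m l x); rewrite e1 mulmxBr mulmxA.
      by rewrite mulmxBr Rl !mulmxA RDL mul1mx subrr.
    have fE k : f k x = b * uv k 0.
      have := eb k 0; rewrite [RHS]mxE => <-; rewrite /f /disp !maxE // se diagAE.
      rewrite mulrAC divff ?gt_eqF // mul1r.
      by rewrite [RHS]mxE [X in _ = _ + X]mxE [X in _ = X + _]mxE.
    by rewrite !fE; ring.
  exists (f i0 t / uv i0 0) => i.
  have fi : f i t = f i0 t / uv i0 0 * uv i 0.
    apply: (mulfI (u_neq0 i0)); rewrite (subr0_eq (F i)).
    by field; exact: u_neq0.
  by have := fi; rewrite {1}/f; lra.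
- move=> i x y x0 xy H; have y0 := le_trans x0 xy; rewrite !maxE // -lerN2.
  apply: (abs_cont_ae_derive_le0 R (fun t => - p t i 0) 0 y) => //.
    by apply: abs_cont_opp; exact: acp.
  apply: (ae_impl _ _ _ ae) => t Ht /andP[xt ty]; have t0 := le_trans x0 xt.
  have A := Ht t0; have [_ [/(_ i) dp _] _ _ _] := A.
  split; first exact: derivableN.
  rewrite deriveN // oppr_le0; have := H t; rewrite xt ty maxE // => /(_ isT) cs_.
  have := flow i (cm i) t _ A; rewrite lexx => /(_ _).
  have [_ [_ [/(_ i) bx _]] _ _ _] := A.
  case/andP: bx => b1 b2; rewrite (le_trans b1 b2) => /(_ isT).
  by rewrite nmulr_lle0 // subr_lt0.
- move=> i x y x0 xy H; have y0 := le_trans x0 xy; rewrite !maxE //.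
  apply: (abs_cont_ae_derive_le0 R (fun t => p t i 0) 0 y) => //; first exact: acp.
  apply: (ae_impl _ _ _ ae) => t Ht /andP[xt ty]; have t0 := le_trans x0 xt.
  have A := Ht t0; have [_ [/(_ i) dp _] _ _ _] := A.
  split => //; have := H t; rewrite xt ty maxE // => /(_ isT) cs_.
  have := flow i (cp i) t _ A; rewrite lexx andbT => /(_ _).
  have [_ [_ [/(_ i) bx _]] _ _ _] := A.
  case/andP: bx => b1 b2; rewrite (le_trans b1 b2) => /(_ isT).
  by rewrite pmulr_lle0 // subr_gt0.
Qed.

End Solution.

(** * From stress components to the norm, and the theorem *)

Lemma enorm_le (R : realType) k (x : 'cV[R]_k) e :
  0 <= e -> (forall i, `|x i 0| <= e) -> enorm x <= k.+1%:R * e.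
Proof.
move=> e0 H; have c0 : 0 <= k.+1%:R * e :> R by rewrite mulr_ge0.
have -> : k.+1%:R * e = Num.sqrt ((k.+1%:R * e) ^+ 2).
  by rewrite sqrtr_sqr ger0_norm.
apply: ler_wsqrtr.
apply: (@le_trans _ _ (\sum_(i < k) e ^+ 2)).
  apply: ler_sum => i _; rewrite -expr2 -real_normK ?num_real //.
  by rewrite ler_pXn2r ?nnegrE.
rewrite sumr_const card_ord -[leLHS]mulr_natl [leRHS]exprMn.
apply: ler_wpM2r; first exact: sqr_ge0.
by rewrite -natrX ler_nat; nia.
Qed.

Theorem theorem7 (R : realType) (n m q : nat)
  (il jl : 'I_m -> 'I_n) (a cm cp : 'I_m -> R)
  (Il Jl : 'I_q -> 'I_n) (Rm : 'M[R]_(m, q)) (Lm : 'M[R]_(n, q))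
  (l : R -> 'cV[R]_q) (hbar : R -> 'cV[R]_m) (T : R) (ubar : 'cV[R]_m) :
  (* network *)
  (forall k, il k != jl k) ->
  (forall x y, connect (edge_rel il jl) x y) ->
  (forall k, 0 < a k) ->
  (forall k, cm k < cp k) ->
  (* R = (R^1,...,R^q): signed chain incidence vectors *)
  (forall k j, Rm k j \in [:: -1; 0; 1]) ->
  (forall (j : 'I_q) (xi : 'cV[R]_n),
      (col j Rm)^T *m (kinD R il jl *m xi) = (xi (Jl j) 0 - xi (Il j) 0)%:M) ->
  \rank (Rm^T *m kinD R il jl) = q ->
  (Rm^T *m kinD R il jl *m Lm = 1%:M) ->
  (forall i, continuous (fun t : R => hbar t i 0)) ->
  (* (i) *)
  n = q.+2 ->
  (* (ii) *)
  (forall k, ~~ blocked il jl Il Jl k) ->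
  (* (iii) *)
  0 < T ->
  Tperiodic T l -> Tperiodic T hbar -> lipschitz_vec l -> lipschitz_vec hbar ->
  (* ubar *)
  inU (kinD R il jl) Rm ubar -> ubar != 0 ->
  (* large stress loading *)
  (exists k : bool, forall (j : 'I_m) (t : R), 0 <= t <= T ->
     dotv ubar (cbar_flip cm cp ubar k j
                + diagA a *m projU a (kinD R il jl) Rm (invmx (diagA a) *m hbar t))
     * dotv ubar (cbar cm cp ubar k
                + diagA a *m projU a (kinD R il jl) Rm (invmx (diagA a) *m hbar t))
     <= 0) ->
  (* large displacement loading *)
  (exists t1 t2 : R, 0 <= t1 < t2 /\
     normA a (invmx (diagA a) *m \col_i cm i - invmx (diagA a) *m \col_i cp i)
     < normA a (projV a (kinD R il jl) Rm (kinD R il jl *m Lm *m l t1)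
                - projV a (kinD R il jl) Rm (kinD R il jl *m Lm *m l t2))) ->
  exists s0 : R -> 'cV[R]_m,
    (forall t, 0 <= t -> s0 (t + T) = s0 t) /\
    forall (s e p : R -> 'cV[R]_m) (r : R -> 'cV[R]_q),
      solution a cm cp il jl Il Jl Rm l hbar s e p r ->
      (fun t : R => enorm (s t - s0 t)) x @[x --> +oo] --> (0 : R).
Proof.
move=> _ _ a0 cmp _ chain rankRD RDL hc nq nb T0 perl perh lipl liph Uu u_nz
  [k stress] [t1 [t2 [/andP[t10 t12] disp_large]]].
have ub0 := ubar_neq0 R n m q il jl Il Jl Rm chain rankRD nq ubar Uu u_nz nb.
have i0 : 'I_m.
  have [i _|H] := pickP (fun i => ubar i 0 != 0); first exact: i.
  exfalso; move/eqP: u_nz; apply; apply/matrixP => i z.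
  by rewrite ord1 mxE; apply/eqP; rewrite -[_ == _]negbK H.
(* Giving [ubar] the sign [k] turns [cbar] for [k] into [corner], so both signs are treated at
   once. *)
pose sg : R := if k then 1 else -1.
pose uv := sg *: ubar.
have sg2 : sg * sg = 1 by rewrite /sg; case: (k); rewrite ?mulrNN mulr1.
have sg0 : sg != 0 by apply/eqP => sg0; move: sg2; rewrite sg0 mul0r => /esym/eqP; rewrite oner_eq0.
have uv0 i : uv i 0 != 0 by rewrite mxE mulf_neq0.
have uv_nz : uv != 0 by rewrite scaler_eq0 negb_or sg0.
have Uuv : inU (kinD R il jl) Rm uv.
  have [[xi e] Re] := Uu; split; first by exists (sg *: xi); rewrite -scalemxAr -e.
  by rewrite -scalemxAr Re scaler0.
pose u i := uv i 0; pose G := disp R n m q il jl Lm l.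
pose h (i : 'I_m) t := hbar t i 0.
have posE i : (0 < u i) = ((0 <= ubar i 0) == k).
  rewrite /u mxE /sg; have := ub0 i; case: (k) => ui.
    by rewrite mul1r lt0r ui eqb_id.
  by rewrite mulN1r oppr_gt0 ltNge eqbF_neg.
have cornerE i : corner R m cm cp u i = cbar cm cp ubar k i 0.
  by rewrite /corner /cbar mxE posE.
have cornerN i : u i * (corner R m cm cp u i - cbar cm cp ubar (~~ k) i 0)
    = `|u i| * (cp i - cm i).
  have -> : cbar cm cp ubar (~~ k) i 0 = if 0 < u i then cm i else cp i.
    by rewrite /cbar mxE posE; case: (0 <= _); case: (k).
  rewrite /corner; case: ltP => ui; [rewrite gtr0_norm | rewrite ler0_norm] => //.
  by ring.
(* As [projU] is the [A]-orthogonal projection onto the line of [ubar], [A h] can be replaced by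
   [hbar] in a product with [ubar]. *)
have stressE t : dotv ubar (cbar cm cp ubar k
      + diagA a *m projU a (kinD R il jl) Rm (invmx (diagA a) *m hbar t))
    = sg * \sum_i u i * (corner R m cm cp u i + h i t).
  rewrite dotvDr (projUE R n m q il jl a Rm a0 rankRD nq ubar Uu u_nz).
  rewrite -scalemxAr dotvZr dotv_diagA -/(energy R m a ubar).
  rewrite -(dotv_coefU R m a a0 ubar u_nz) mulKVmx ?(diagA_unit R m a a0) //.
  rewrite /dotv -big_split mulr_sumr /=; apply: eq_bigr => i _.
  by rewrite cornerE /u [uv i 0]mxE mulrA mulrA sg2 mul1r mulrDr.
have flipE j t : dotv ubar (cbar_flip cm cp ubar k j
      + diagA a *m projU a (kinD R il jl) Rm (invmx (diagA a) *m hbar t))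
    = sg * (\sum_i u i * (corner R m cm cp u i + h i t) - `|u j| * (cp j - cm j)).
  rewrite mulrBr -stressE -cornerN !dotvDr addrAC; congr (_ + _).
  rewrite /dotv (bigD1 j) //= [in RHS](bigD1 j) //= addrAC; congr (_ + _).
    rewrite [cbar_flip _ _ _ _ _ j 0]mxE eqxx cornerE /u [uv j 0]mxE !mulrA sg2 mul1r.
    by ring.
  by apply: eq_bigr => i /negbTE ij; rewrite [cbar_flip _ _ _ _ _ i 0]mxE ij.
have hT i : Tperiodic T (h i) by move=> t; rewrite /h perh.
have GT i : Tperiodic T (G i) by move=> t; rewrite /G /disp perl.
have simplex j t : 0 <= t ->
    \sum_i u i * (corner R m cm cp u i + h i t) <= `|u j| * (cp j - cm j).
  move: t; apply: (Tperiodic_bound R T) => // [t|t tT].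
    by apply: eq_bigr => i _; rewrite (hT i t).
  (* With [X] the sum and [w > 0] its claimed bound, the loading condition reads [(X - w) * X <= 0],
     which excludes [X > w]. *)
  have := stress j t tT; rewrite flipE stressE mulrACA sg2 mul1r.
  have d0 : 0 < `|u j| * (cp j - cm j).
    by rewrite mulr_gt0 ?subr_gt0 // normr_gt0 uv0.
  rewrite leNgt => /negP; apply: contra_notT; rewrite -ltNge => lt.
  by rewrite mulr_gt0 ?subr_gt0 //; lra.
have [eta eta0 Heta] : exists2 eta, 0 < eta & forall (s1 s2 rho : 'I_m -> R) (b : R),
    (forall i, cm i <= s1 i <= cp i) -> (forall i, cm i <= s2 i <= cp i) ->
    (forall i, (s2 i - s1 i) / a i + rho i = G i t2 - G i t1 + b * u i) ->
    exists i, eta < `|rho i|.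
  move: disp_large; rewrite !normAE => disp_large.
  have : energy R m a (invmx (diagA a) *m \col_i cm i - invmx (diagA a) *m \col_i cp i)
     < energy R m a (projV a (kinD R il jl) Rm (kinD R il jl *m Lm *m l t1)
                - projV a (kinD R il jl) Rm (kinD R il jl *m Lm *m l t2)).
    rewrite ltNge; apply: contraTN disp_large => le; rewrite -leNgt.
    exact: ler_wsqrtr.
  move=> /(energy_slack R m a cm cp a0 _ cmp)[eta eta0 H]; exists eta => //.
  move=> s1 s2 rho b b1 b2 e; apply: contrapT => nx.
  (* If all [rho i] were at most [eta], [energy_slack] would bound the energy of [v]; but its
     projection onto [V] is the increment of [g]. *)
  pose v : 'cV[R]_m := \col_i ((s2 i - s1 i) / a i + rho i).
  have vE : v = kinD R il jl *m Lm *m l t2 - kinD R il jl *m Lm *m l t1 + b *: uv.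
    have combE (X Y W : 'cV[R]_m) c i :
        (X - Y + c *: W) i 0 = X i 0 - Y i 0 + c * W i 0 by rewrite !mxE.
    by apply/matrixP => i z; rewrite ord1 combE -e mxE.
  have := H v; rewrite ltNge => /(_ _)/negP; apply.
    move=> i; rewrite mxE; apply: le_trans (ler_normD _ _) _; apply: lerD.
      rewrite normrM normfV (gtr0_norm (a0 i)) ler_pM2r ?invr_gt0 //.
      by have /andP[? ?] := b1 i; have /andP[? ?] := b2 i; rewrite ler_norml;
        apply/andP; split; lra.
    by rewrite leNgt; apply/negP => ?; apply: nx; exists i.
  apply: le_trans (energy_projV R n m q il jl a Rm a0 rankRD nq uv Uuv uv_nz v).
  rewrite (projV_shift R n m q il jl a Rm a0 rankRD nq uv Uuv uv_nz _ _ _ _ vE).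
  have energyC (X Y : 'cV[R]_m) : energy R m a (X - Y) = energy R m a (Y - X).
    by apply: eq_bigr => i _; rewrite !mxE; ring.
  by rewrite energyC.
have evo s e p r := solution_evolution R n m q il jl a cm cp Il Jl Rm Lm l hbar uv
  a0 chain rankRD RDL nq lipl hc Uuv uv0 i0 s e p r.
(* Without any solution the claim is vacuous and the zero function will do; otherwise one solution
   generates [s0]. *)
have [[s [e [p [r sol]]]]|none] := pselect (exists s e p r,
    solution a cm cp il jl Il Jl Rm l hbar s e p r); last first.
  exists (fun=> 0); split => // s e p r sol; exfalso; apply: none.
  by exists s, e, p, r.
have [s0 [per0 H]] := periodic_attractor R m a cm cp u G h a0 cmp uv0 simplex T t1 t2 eta
  T0 hT GT t10 t12 eta0 Heta _ _ (evo s e p r sol).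
exists (fun t => \col_i s0 i t); split.
  by move=> t t0; apply/matrixP => i z; rewrite !mxE per0.
move=> s1 e1 p1 r1 sol1; apply/cvgrPdist_lt => eps eps0.
(* [m.+2] against the factor [m.+1] of [enorm_le] makes the final inequality strict. *)
have M0 : 0 < m.+2%:R :> R by rewrite ltr0n.
have [tau Htau] := H (eps / m.+2%:R) (divr_gt0 eps0 M0).
exists (Num.max 0 tau); split; first exact: num_real.
move=> t; rewrite gt_max => /andP[t0 tt] /=.
rewrite sub0r normrN ger0_norm ?sqrtr_ge0 //.
apply: (@le_lt_trans _ _ (m.+1%:R * (eps / m.+2%:R))).
  apply: enorm_le; first by rewrite divr_ge0 ?ltW.
  move=> i; rewrite !mxE; have := Htau _ _ (evo _ _ _ _ sol1) t i (ltW tt).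
  by have /max_idPr -> := ltW t0.
by rewrite mulrCA gtr_pMr // ltr_pdivrMr // mul1r ltr_nat.
Qed.
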